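(* Let $q>n$ be a real number and let $k\in\{1,\ldots,n-1\}$. There exist a sequence of origin-symmetric convex bodies $K_l\in\mathcal{K}_e^n$, $l\in\mathbb{N}$, and a $k$-dimensional linear subspace $L\subset\mathbb{R}^n$ such that $$\lim_{l\to\infty}\frac{\widetilde{\mathrm{C}}_q(K_l,\mathbb{S}^{n-1}\cap L)}{\widetilde{\mathrm{C}}_q(K_l,\mathbb{S}^{n-1})}=\frac{q-n+k}{q}.$$
   Context: A convex body in $\mathbb{R}^n$ is a non-empty convex compact subset of $\mathbb{R}^n$. $\mathcal{K}_o^n$ is the set of convex bodies in $\mathbb{R}^n$ having the origin as an interior point, and $\mathcal{K}_e^n$ is the set of those $K\in\mathcal{K}_o^n$ with $K=-K$. $\langle\cdot,\cdot\rangle$ is the standard inner product, $|\cdot|$ the Euclidean norm, $\mathbb{S}^{n-1}$ the Euclidean unit sphere in $\mathbb{R}^n$, and $\mathcal{H}^{n-1}$ the $(n-1)$-dimensional Hausdorff measure. For $K\in\mathcal{K}_o^n$: the support function is $h_K(x)=\max_{y\in K}\langle x,y\rangle$; the radial function is $\rho_K(x)=\max\{\rho>0:\rho x\in K\}$ for $x\in\mathbb{R}^n\setminus\{0\}$; for $v\in\mathbb{S}^{n-1}$ the supporting hyperplane is $H_K(v)=\{x\in\mathbb{R}^n:\langle x,v\rangle=h_K(v)\}$. For $\eta\subseteq\mathbb{S}^{n-1}$ the reverse radial Gauss image is $$\alpha_K^*(\eta)=\{u\in\mathbb{S}^{n-1}:\rho_K(u)u\in H_K(v)\text{ for some }v\in\eta\}.$$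 For $q\in\mathbb{R}$ the $q$th dual curvature measure of $K$ is defined for Borel sets $\eta\subseteq\mathbb{S}^{n-1}$ by $$\widetilde{\mathrm{C}}_q(K,\eta)=\frac1n\int_{\alpha_K^*(\eta)}\rho_K(u)^q\,d\mathcal{H}^{n-1}(u).$$ *)

(* Defs.v *)
From HB Require Import structures.
From mathcomp Require Import all_boot all_order all_algebra.
From mathcomp Require Import all_classical all_reals all_analysis.

Set Implicit Arguments.
Unset Strict Implicit.
Unset Printing Implicit Defensive.

Import Order.TTheory GRing.Theory Num.Theory.
Import numFieldNormedType.Exports.

Local Open Scope classical_set_scope.
Local Open Scope ring_scope.

(* The library norm on 'rV[R]_n is the sup norm; it induces the usual topology,
   but the Euclidean norm has to be defined separately. *)
Definition dotp (R : realType) (n : nat) (x y : 'rV[R]_n) : R :=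
  \sum_(i < n) x ord0 i * y ord0 i.

Definition enorm (R : realType) (n : nat) (x : 'rV[R]_n) : R :=
  Num.sqrt (dotp x x).

Definition unit_sphere (R : realType) (n : nat) : set 'rV[R]_n :=
  [set u | enorm u = 1].
Arguments unit_sphere R n : clear implicits.

(* -oo for the empty set *)
Definition ediam (R : realType) (n : nat) (A : set 'rV[R]_n) : \bar R :=
  ereal_sup [set (enorm (p.1 - p.2))%:E | p in A `*` A].

(* pi^(m/2) / Gamma(m/2 + 1), the volume of the Euclidean unit ball of R^m *)
Fixpoint unit_ball_volume (R : realType) (m : nat) : R :=
  match m with
  | 0 => 1
  | 1 => 2
  | m'.+2 => 2 * pi / m'.+2%:R * unit_ball_volume R m'
  end.

(* The factor makes H^m agree with m-dimensional Lebesgue measure on R^m; the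
   empty set is singled out so that it weighs 0 also for m = 0. *)
Definition hausdorff_weight (R : realType) (n m : nat) (A : set 'rV[R]_n)
    : \bar R :=
  if A == set0 then 0%E
  else ((unit_ball_volume R m / 2 ^+ m)%:E * ediam A ^+ m)%E.

Definition hausdorff_premeasure (R : realType) (n m : nat) (delta : R)
    (A : set 'rV[R]_n) : \bar R :=
  ereal_inf [set (\sum_(i <oo) hausdorff_weight m (F i))%E | F in
    [set F : (set 'rV[R]_n)^nat |
      A `<=` \bigcup_i F i /\ forall i, (ediam (F i) <= delta%:E)%E]].

Definition hausdorff_outer (R : realType) (n m : nat) (A : set 'rV[R]_n)
    : \bar R :=
  ereal_sup [set hausdorff_premeasure m delta A | delta in [set d | 0 < d]].

Lemma unit_ball_volume_ge0 (R : realType) m : 0 <= unit_ball_volume R m.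
Proof.
suff : 0 <= unit_ball_volume R m /\ 0 <= unit_ball_volume R m.+1 by case.
elim: m => [|m [IH1 IH2]]; first by split; rewrite /= ?ler01 ?ler0n.
split=> //; rewrite [unit_ball_volume _ _.+2]/=.
by rewrite mulr_ge0 // divr_ge0 // mulr_ge0 // pi_ge0.
Qed.

Section hausdorff_outer_measure.
Context (R : realType) (n m : nat).
Let V := 'rV[R]_n.
Implicit Types A B : set V.

Lemma ediam_ge0 A : A !=set0 -> (0 <= ediam A)%E.
Proof.
move=> [x Ax]; apply: (@le_trans _ _ (enorm (x - x))%:E).
  by rewrite lee_fin sqrtr_ge0.
by apply: ereal_sup_ubound; exists (x, x).
Qed.

Lemma ediam_set0 : ediam (set0 : set V) = -oo%E.
Proof. by rewrite /ediam set0X image_set0 ereal_sup0. Qed.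

Lemma hausdorff_weight0 : hausdorff_weight m (set0 : set V) = 0%E.
Proof. by rewrite /hausdorff_weight eqxx. Qed.

Lemma hausdorff_weight_ge0 A : (0 <= hausdorff_weight m A)%E.
Proof.
rewrite /hausdorff_weight; case: ifPn => // /set0P A0.
rewrite mule_ge0 //; first by rewrite lee_fin divr_ge0 // unit_ball_volume_ge0.
by rewrite expe_ge0 // ediam_ge0.
Qed.

Lemma hausdorff_premeasure_ge0 delta A :
  (0 <= hausdorff_premeasure m delta A)%E.
Proof.
apply: le_ereal_inf_tmp => _ [F _ <-].
by apply: nneseries_ge0 => i _ _; exact: hausdorff_weight_ge0.
Qed.

Lemma hausdorff_premeasure0 delta :
  hausdorff_premeasure m delta (set0 : set V) = 0%E.
Proof.
apply/eqP; rewrite eq_le hausdorff_premeasure_ge0 andbT.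
apply: ereal_inf_lbound; exists (fun=> set0).
  by split=> // i; rewrite ediam_set0 leNye.
by rewrite eseries0 // => i _ _; exact: hausdorff_weight0.
Qed.

Lemma le_hausdorff_premeasure delta :
  {homo @hausdorff_premeasure R n m delta : A B / A `<=` B >-> (A <= B)%E}.
Proof.
move=> A B AB; apply: ereal_inf_le_tmp => _ [F [BF dF] <-].
by exists F => //; split=> //; exact: subset_trans BF.
Qed.

Lemma hausdorff_premeasure_sigma_subadditive delta :
  sigma_subadditive (hausdorff_premeasure m delta : set V -> \bar R).
Proof.
pose mu := hausdorff_premeasure m delta : set V -> \bar R.
move=> A; have [[i ioo]|] := pselect (exists i, mu (A i) = +oo%E).
  rewrite (eseries_pinfty _ _ ioo) ?leey // => j _.
  by rewrite -ltNye (lt_le_trans _ (hausdorff_premeasure_ge0 _ _)).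
rewrite -forallNE => Aoo.
suff add2e (e : {posnum R}) :
    (mu (\bigcup_n A n) <= \sum_(i <oo) mu (A i) + e%:num%:E)%E.
  by apply/lee_addgt0Pr => _/posnumP[].
apply: (le_trans _ (epsilon_trick _ _ _)) => //; last first.
  by move=> j; exact: hausdorff_premeasure_ge0.
have muAfin j : mu (A j) \is a fin_num.
  rewrite ge0_fin_numE; last exact: hausdorff_premeasure_ge0.
  by rewrite ltey; apply/eqP; exact: Aoo.
have [G PG] : {G : ((set V)^nat)^nat & forall j,
    (A j `<=` \bigcup_i G j i /\ forall i, (ediam (G j i) <= delta%:E)%E) /\
    (\sum_(i <oo) hausdorff_weight m (G j i)
       <= mu (A j) + (e%:num / (2 ^ j.+1)%:R)%:E)%E}.
  apply: (@choice _ _ (fun j (F : (set V)^nat) =>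
    (A j `<=` \bigcup_i F i /\ forall i, (ediam (F i) <= delta%:E)%E) /\
    (\sum_(i <oo) hausdorff_weight m (F i)
       <= mu (A j) + (e%:num / (2 ^ j.+1)%:R)%:E)%E)) => j.
  have e0 : (0 < e%:num / (2 ^ j.+1)%:R)%R by [].
  by have [_ [F HF <-] /ltW] := lb_ereal_inf_adherent e0 (muAfin j); exists F.
have w0 x : (0 <= (hausdorff_weight m \o uncurry G) x)%E.
  exact: hausdorff_weight_ge0.
apply: (@le_trans _ _ (\esum_(i in setT) (hausdorff_weight m \o uncurry G) i)%E).
  apply: ereal_inf_lbound => /=.
  have /card_esym/ppcard_eqP[f] := card_nat2.
  exists (uncurry G \o f).
    split; last first.
      move=> i; rewrite /= /uncurry; case: (f i) => a b.
      exact: (PG a).1.2.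
    move=> t [i _] /(PG i).1.1 [j _ Gt].
    by exists (f^-1%FUN (i, j)) => //=; rewrite invK ?inE.
  rewrite nneseries_esumT; last by move=> i; exact: w0.
  exact/esym/reindex_esum.
rewrite (_ : esum _ _ =
    \sum_(i <oo) \sum_(j <oo) hausdorff_weight m (G i j))%E; last first.
  rewrite nneseries_esumT; last first.
    by move=> i; apply: nneseries_ge0 => *; exact: hausdorff_weight_ge0.
  rewrite (eq_esum (b := fun i => \esum_(j in setT) hausdorff_weight m (G i j))%E);
    last by move=> i _; rewrite nneseries_esumT // => j; exact: w0 (i, j).
  rewrite esum_esum; last by move=> i j _ _; exact: w0 (i, j).
  rewrite (_ : _ `*`` _ = setT); last by apply/seteqP; split=> // -[].
  by apply: eq_esum => -[].
apply: lee_nneseries => [i _ _|i _ ]; last exact: (PG i).2.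
by apply: nneseries_ge0 => *; exact: hausdorff_weight_ge0.
Qed.

Lemma hausdorff_outer0 : hausdorff_outer m (set0 : set V) = 0%E.
Proof.
apply/eqP; rewrite eq_le; apply/andP; split.
  by apply: ge_ereal_sup => _ [d _ <-]; rewrite hausdorff_premeasure0.
apply: ereal_sup_ubound; exists 1; first exact: ltr01.
exact: hausdorff_premeasure0.
Qed.

Lemma hausdorff_outer_ge0 A : (0 <= hausdorff_outer m A)%E.
Proof.
apply: (@le_trans _ _ (hausdorff_premeasure m 1 A)).
  exact: hausdorff_premeasure_ge0.
by apply: ereal_sup_ubound; exists 1 => //=.
Qed.

Lemma le_hausdorff_outer :
  {homo @hausdorff_outer R n m : A B / A `<=` B >-> (A <= B)%E}.
Proof.
move=> A B AB; apply: ge_ereal_sup => _ [d d0 <-].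
apply: le_trans (le_hausdorff_premeasure d AB) _.
by apply: ereal_sup_ubound; exists d.
Qed.

Lemma hausdorff_outer_sigma_subadditive :
  sigma_subadditive (@hausdorff_outer R n m).
Proof.
move=> F; apply: ge_ereal_sup => _ [d d0 <-].
apply: le_trans (hausdorff_premeasure_sigma_subadditive d F) _.
apply: lee_nneseries => [i _ _|i _]; first exact: hausdorff_premeasure_ge0.
by apply: ereal_sup_ubound; exists d.
Qed.

HB.instance Definition _ := isOuterMeasure.Build R V (@hausdorff_outer R n m)
  hausdorff_outer0 hausdorff_outer_ge0 le_hausdorff_outer
  hausdorff_outer_sigma_subadditive.

End hausdorff_outer_measure.

Definition hausdorff_outer_measure (R : realType) (n m : nat) :
    {outer_measure set 'rV[R]_n -> \bar R} := @hausdorff_outer R n m.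

(* H^m on the sigma-algebra of Caratheodory-measurable sets, which contains the
   Borel sets. *)
Definition hausdorff_measure (R : realType) (n m : nat) :
    {measure set (caratheodory_type (hausdorff_outer_measure R n m)) -> \bar R} :=
  (hausdorff_outer_measure R n m
    : set (caratheodory_type (hausdorff_outer_measure R n m)) -> \bar R).

Definition convex_body (R : realType) (n : nat) (K : set 'rV[R]_n) : Prop :=
  [/\ K !=set0, compact K & convex_set K].

Definition convex_body_o (R : realType) (n : nat) (K : set 'rV[R]_n) : Prop :=
  convex_body K /\ K° 0.

Definition convex_body_e (R : realType) (n : nat) (K : set 'rV[R]_n) : Prop :=
  convex_body_o K /\ K = [set - x | x in K].

(* For K in K_o^n the suprema in [support_fun] and [radial_fun] (the latter at
   x <> 0) are maxima, by compactness. *)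
Definition support_fun (R : realType) (n : nat) (K : set 'rV[R]_n)
    (x : 'rV[R]_n) : R :=
  sup [set dotp x y | y in K].

Definition radial_fun (R : realType) (n : nat) (K : set 'rV[R]_n)
    (x : 'rV[R]_n) : R :=
  sup [set r : R | 0 < r /\ K (r *: x)].

Definition supporting_hyperplane (R : realType) (n : nat) (K : set 'rV[R]_n)
    (v : 'rV[R]_n) : set 'rV[R]_n :=
  [set x | dotp x v = support_fun K v].

Definition reverse_radial_gauss (R : realType) (n : nat)
    (K eta : set 'rV[R]_n) : set 'rV[R]_n :=
  [set u | unit_sphere R n u /\
    exists2 v, eta v & supporting_hyperplane K v (radial_fun K u *: u)].

(* [powR] agrees with the usual real power here since radial_fun K u > 0. *)
Definition dual_curvature (R : realType) (n : nat) (q : R)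
    (K eta : set 'rV[R]_n) : \bar R :=
  ((n%:R^-1)%:E *
   \int[hausdorff_measure R n n.-1]_(u in reverse_radial_gauss K eta)
     (radial_fun K u `^ q)%:E)%E.

(* Main.v *)
(** Let K_e be the set of the (a, b) in R^k x R^(n-k) with |a| <= 1 and
|b_i| <= e for all i, let L = R^k x 0 and m = n - k. On the unit sphere the
radial function of K_e is 1/max(|a|, h/e), where h = max_i |b_i|, and a
direction lies in the reverse radial Gauss image of L exactly when
h/e <= |a|. As e tends to 0 all the mass concentrates near the sphere of L,
where |a| is close to 1. Let F(s) be the H^(n-1)-measure of the band {h <= s}
of the sphere. Then C_q(K_e, L) is asymptotic to F(e)/n, while C_q(K_e) is
asymptotic to E(e)/n, where E(e) is the integral of max(1, h/e)^(-q).

The band {h <= s} is (1 + O(s))-bilipschitz to S^(k-1) x [-s, s]^m, whose measure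
is exactly proportional to s^m by additivity and translation invariance. Hence
F(s) ~ c s^m with 0 < c < oo. For l > 1 the function p(t) = max(1, t)^(-q) satisfies
  l^(-q) p(t/l) + (1 - l^(-q)) 1_{t <= 1} <= p(t)
    <= l^(-q) p(t/l) + (1 - l^(-q)) 1_{t <= l},
so that E(e) - l^(-q) E(l e) lies between (1 - l^(-q)) F(e) and
(1 - l^(-q)) F(l e). Iterating and letting l tend to 1 gives
E(e) ~ c (q/(q - m)) e^m, and the ratio tends to (q - m)/q = (q - n + k)/q. *)

Require Import Defs.
From HB Require Import structures.
From mathcomp Require Import all_boot all_order all_algebra.
From mathcomp Require Import all_classical all_reals all_analysis.
From mathcomp Require Import measurable_realfun ring lra.

Import Order.TTheory GRing.Theory Num.Theory.
Import numFieldNormedType.Exports.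

Local Open Scope classical_set_scope.
Local Open Scope ring_scope.

(** * Euclidean norm *)

(** The obstacle is that the Hausdorff measure is known only through coverings: no area formula and
    no polar coordinates are used. Two properties carry the argument, the behaviour under Lipschitz
    maps and the additivity across sublevel sets of Lipschitz functions. This explains the sup norm
    h on the tail: the sections [-s, s]^m are translates of boxes that can be cut along coordinate
    hyperplanes, so their measure is determined up to the factor c without being computed. The value
    of c cancels in the quotient; only 0 < c < oo has to be known. Finiteness comes from covering
    the sphere by Lipschitz images of cubes, positivity from a projection onto a cube, whose measure
    is positive by compactness. The inequalities between E(e) and E(l e) replace an integration of F
    over all scales, for which the asymptotics of F near 0 alone would have to be split off from its
    values far from 0. *)

Section Euclid.
Context {R : realType} {n : nat}.
Implicit Types x y z : 'rV[R]_n.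

Lemma dotpC x y : dotp x y = dotp y x.
Proof. by apply: eq_bigr => i _; rewrite mulrC. Qed.

Lemma dotpDl x y z : dotp (x + y) z = dotp x z + dotp y z.
Proof. by rewrite -big_split; apply: eq_bigr => i _; rewrite mxE mulrDl. Qed.

Lemma dotpDr x y z : dotp z (x + y) = dotp z x + dotp z y.
Proof. by rewrite dotpC dotpDl !(dotpC z). Qed.

Lemma dotpZl a x y : dotp (a *: x) y = a * dotp x y.
Proof. by rewrite mulr_sumr; apply: eq_bigr => i _; rewrite mxE mulrA. Qed.

Lemma dotpZr a x y : dotp x (a *: y) = a * dotp x y.
Proof. by rewrite dotpC dotpZl dotpC. Qed.

Lemma dotp_delta x i : dotp x (delta_mx 0 i) = x ord0 i.
Proof.
rewrite /dotp (bigD1 i) //= mxE !eqxx mulr1 big1 ?addr0 // => j ji.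
by rewrite mxE (negbTE ji) mulr0.
Qed.

Lemma dotpxx_ge0 x : 0 <= dotp x x.
Proof. by apply: sumr_ge0 => i _; rewrite -expr2 sqr_ge0. Qed.

Lemma enorm_ge0 x : 0 <= enorm x.
Proof. exact: sqrtr_ge0. Qed.

Lemma enorm_sqr x : enorm x ^+ 2 = dotp x x.
Proof. by rewrite sqr_sqrtr // dotpxx_ge0. Qed.

Lemma enorm_le x (a : R) : 0 <= a -> (enorm x <= a) = (dotp x x <= a ^+ 2).
Proof.
by move=> a0; rewrite -enorm_sqr ler_pXn2r // nnegrE ?enorm_ge0.
Qed.

Lemma coord_le_enorm x i : `|x ord0 i| <= enorm x.
Proof.
rewrite -(ler_pXn2r (ltn0Sn 1)) ?nnegrE ?enorm_ge0 // enorm_sqr.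
rewrite real_normK ?num_real // /dotp (bigD1 i) //= -expr2 lerDl.
by apply: sumr_ge0 => j _; rewrite -expr2 sqr_ge0.
Qed.

Lemma enorm0_eq0 x : enorm x = 0 -> x = 0.
Proof.
move=> x0; apply/rowP => i; rewrite mxE; apply/eqP; rewrite -normr_eq0.
by rewrite eq_le normr_ge0 andbT -x0 coord_le_enorm.
Qed.

Lemma enorm0 : enorm (0 : 'rV[R]_n) = 0.
Proof. by rewrite /enorm /dotp big1 ?sqrtr0 // => i _; rewrite mxE mul0r. Qed.

Lemma enormZ a x : enorm (a *: x) = `|a| * enorm x.
Proof.
by rewrite /enorm dotpZl dotpZr mulrA -expr2 sqrtrM ?sqr_ge0 // sqrtr_sqr.
Qed.

Lemma enormN x : enorm (- x) = enorm x.
Proof. by rewrite -scaleN1r enormZ normrN1 mul1r. Qed.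

Lemma enormB x y : enorm (x - y) = enorm (y - x).
Proof. by rewrite -enormN opprB. Qed.

(** The square of | |y| x - |x| y | equals 2 |x| |y| (|x| |y| - <x, y>); dividing by |x| |y| forces
    the separate treatment of zero vectors. *)
Lemma cauchy_schwarz x y : dotp x y <= enorm x * enorm y.
Proof.
have [x0|x0] := eqVneq (enorm x) 0.
  by rewrite (enorm0_eq0 _ x0) enorm0 mul0r /dotp big1 // => i _; rewrite mxE mul0r.
have [y0|y0] := eqVneq (enorm y) 0.
  by rewrite (enorm0_eq0 _ y0) enorm0 mulr0 /dotp big1 // => i _; rewrite mxE mulr0.
have xp : 0 < enorm x by rewrite lt_neqAle eq_sym x0 enorm_ge0.
have yp : 0 < enorm y by rewrite lt_neqAle eq_sym y0 enorm_ge0.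
have := dotpxx_ge0 (enorm y *: x - enorm x *: y).
rewrite -scaleNr dotpDl !dotpDr !dotpZl !dotpZr -!enorm_sqr (dotpC y x) => H.
have xy0 : 0 < enorm x * enorm y by rewrite mulr_gt0.
rewrite -(ler_pM2l xy0).
move: H; lra.
Qed.

Lemma ler_enormD x y : enorm (x + y) <= enorm x + enorm y.
Proof.
rewrite enorm_le ?addr_ge0 ?enorm_ge0 // dotpDl !dotpDr (dotpC y x) -!enorm_sqr.
have := cauchy_schwarz x y; lra.
Qed.

(** The crude factor n instead of its square root keeps roots out of the later estimates; it is the
    origin of the products n s. *)
Lemma enorm_le_coord x (a : R) : 0 <= a -> (forall i, `|x ord0 i| <= a) ->
  enorm x <= n%:R * a.
Proof.
move=> a0 xa; rewrite enorm_le ?mulr_ge0 //.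
apply: (@le_trans _ _ (\sum_(i < n) a ^+ 2)).
  apply: ler_sum => i _; rewrite -expr2 -(real_normK (num_real _)).
  by rewrite ler_pXn2r // nnegrE.
rewrite sumr_const card_ord exprMn -[leLHS]mulr_natl ler_wpM2r ?sqr_ge0 //.
by rewrite -natrX ler_nat; case: (n) => // p; rewrite leq_pmulr.
Qed.

Lemma le_enorm (x y : 'rV[R]_n) :
  (forall i, `|x ord0 i| <= `|y ord0 i|) -> enorm x <= enorm y.
Proof.
move=> xy; rewrite enorm_le ?enorm_ge0 // enorm_sqr; apply: ler_sum => i _.
rewrite -!expr2 -(real_normK (num_real (x _ _))) -(real_normK (num_real (y _ _))).
by rewrite ler_pXn2r ?nnegrE.
Qed.

(** With a = |x|, b = |y|, c = <x, y>, squaring and clearing denominators gives 2 r^2 (ab - c) <= ab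
    ((a - b)^2 + 2 (ab - c)), which follows from r^2 <= ab and Cauchy-Schwarz. *)
Lemma normalize_lipschitz x y r : 0 < r -> r <= enorm x -> r <= enorm y ->
  enorm ((enorm x)^-1 *: x - (enorm y)^-1 *: y) <= r^-1 * enorm (x - y).
Proof.
move=> r0 rx ry.
have x0 := lt_le_trans r0 rx; have y0 := lt_le_trans r0 ry.
rewrite enorm_le ?mulr_ge0 ?enorm_ge0 ?invr_ge0 ?(ltW r0) //.
rewrite exprMn enorm_sqr -!scaleNr -(scaleN1r y) !(dotpDl, dotpDr, dotpZl, dotpZr).
rewrite -!enorm_sqr (dotpC y x).
move: (cauchy_schwarz x y) x0 y0 rx ry.
move: (enorm x) (enorm y) (dotp x y) => a b c ca a0 b0 ra rb.
rewrite -(ler_pM2l (_ : 0 < r ^+ 2 * (a * b))); last by rewrite !mulr_gt0 ?exprn_gt0.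
rewrite [leLHS](_ : _ = 2 * r ^+ 2 * (a * b - c)); last first.
  by field; rewrite !gt_eqF.
rewrite [leRHS](_ : _ = (a * b) * ((a - b) ^+ 2 + 2 * (a * b - c))); last first.
  by field; rewrite !gt_eqF.
apply: (@le_trans _ _ (a * b * (2 * (a * b - c)))); last first.
  by rewrite ler_wpM2l ?lerDr ?sqr_ge0 // mulr_ge0 // ltW.
rewrite mulrA [a * b * 2]mulrC ler_wpM2r ?subr_ge0 // ler_wpM2l // expr2.
by rewrite ler_pM // ltW.
Qed.

End Euclid.

(** * Hausdorff outer measures *)

Section Hausdorff.
Context {R : realType}.
Local Open Scope ereal_scope.

Lemma ediam_leP {n} (A : set 'rV[R]_n) (a : \bar R) :
  (forall x y, A x -> A y -> (enorm (x - y))%:E <= a) <-> ediam A <= a.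
Proof.
split=> [H|Aa x y Ax Ay].
  by apply: ge_ereal_sup => _ [[x y] [/= Ax Ay] <-]; exact: H.
by apply: le_trans Aa; apply: ereal_sup_ubound; exists (x, y).
Qed.

Lemma lee_expe (x y : \bar R) m : 0 <= x -> x <= y -> x ^+ m <= y ^+ m.
Proof.
move=> x0 xy; elim: m => [|m IH]; first by rewrite !expe0.
by rewrite !expeS lee_pmul // expe_ge0.
Qed.

Lemma expeZ (c : R) (x : \bar R) m : (c%:E * x) ^+ m = (c ^+ m)%:E * x ^+ m.
Proof.
elim: m => [|m IH]; first by rewrite !expe0 expr0 mul1e.
by rewrite !expeS IH exprS EFinM !muleA (muleAC _ _ x).
Qed.

Lemma hausdorff_weight_lipschitz {n p} m (A : set 'rV[R]_n) (f : 'rV[R]_n -> 'rV[R]_p)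
    (c : R) : (0 <= c)%R ->
  (forall x y, A x -> A y -> (enorm (f x - f y) <= c * enorm (x - y))%R) ->
  hausdorff_weight m (f @` A) <= (c ^+ m)%:E * hausdorff_weight m A.
Proof.
move=> c0 lip; rewrite /hausdorff_weight; have [->|A0] := eqVneq A set0.
  by rewrite image_set0 eqxx mule0.
have fA0 : f @` A != set0 by move/set0P : A0 => [x Ax]; apply/set0P; exists (f x); exists x.
rewrite (negbTE fA0) muleCA lee_wpmul2l //.
  by rewrite lee_fin divr_ge0 // unit_ball_volume_ge0.
rewrite -expeZ lee_expe //; first exact/ediam_ge0/set0P.
apply/ediam_leP => _ _ [x Ax <-] [y Ay <-].
apply: (@le_trans _ _ (c%:E * (enorm (x - y))%:E)).
  by rewrite -EFinM lee_fin lip.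
rewrite lee_wpmul2l //; exact: (ediam_leP _ _).2.
Qed.

Lemma le_hausdorff_weight {n} m (A B : set 'rV[R]_n) :
  A `<=` B -> hausdorff_weight m A <= hausdorff_weight m B.
Proof.
move=> AB; have [->|A0] := eqVneq A set0.
  by rewrite hausdorff_weight0 hausdorff_weight_ge0.
rewrite /hausdorff_weight (negbTE A0).
have /set0P[x Ax] := A0.
have -> : (B == set0) = false by apply/negbTE/set0P; exists x; exact: AB.
rewrite lee_wpmul2l ?lee_fin ?divr_ge0 ?unit_ball_volume_ge0 // lee_expe //.
  exact/ediam_ge0/set0P.
by apply/ediam_leP => y z /AB By /AB Bz; exact: (ediam_leP _ _).2.
Qed.

(** Covers of A at scale d / c are pushed forward to covers of the image at scale d. The covering
    sets are first cut down to A, where alone [f] is controlled. *)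
Lemma hausdorff_outer_lipschitz {n p} m (A : set 'rV[R]_n) (f : 'rV[R]_n -> 'rV[R]_p)
    (c : R) : (0 < c)%R ->
  (forall x y, A x -> A y -> (enorm (f x - f y) <= c * enorm (x - y))%R) ->
  hausdorff_outer m (f @` A) <= (c ^+ m)%:E * hausdorff_outer m A.
Proof.
move=> c0 lip; apply: ge_ereal_sup => _ [d d0 <-].
apply: (@le_trans _ _ ((c ^+ m)%:E * hausdorff_premeasure m (d / c)%R A)); last first.
  rewrite lee_wpmul2l ?lee_fin ?exprn_ge0 ?(ltW c0) //.
  by apply: ereal_sup_ubound; exists (d / c)%R => //; rewrite /= divr_gt0.
rewrite -lee_pdivrMl ?exprn_gt0 //.
apply: le_ereal_inf_tmp => _ [F [AF dF] <-].
rewrite lee_pdivrMl ?exprn_gt0 // -nneseriesZl; last first.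
  by move=> i _; exact: hausdorff_weight_ge0.
have lipF i x y : (F i `&` A) x -> (F i `&` A) y ->
    (enorm (f x - f y) <= c * enorm (x - y))%R by move=> [_ Ax] [_ Ay]; exact: lip.
apply: (@le_trans _ _ (\sum_(i <oo) hausdorff_weight m (f @` (F i `&` A)))).
  apply: ereal_inf_lbound; exists (fun i => f @` (F i `&` A)) => //; split.
    by move=> _ [x Ax <-]; have [i _ Fx] := AF x Ax; exists i => //; exists x.
  move=> i; apply/ediam_leP => _ _ [x [Fx Ax] <-] [y [Fy Ay] <-].
  have := (ediam_leP _ _).2 (dF i) x y Fx Fy; rewrite !lee_fin => xy.
  by rewrite (le_trans (lip _ _ Ax Ay)) // -ler_pdivlMl // mulrC.
apply: lee_nneseries => i _; first by move=> _; exact: hausdorff_weight_ge0.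
apply: le_trans (hausdorff_weight_lipschitz m _ _ _ (ltW c0) (lipF i)) _.
rewrite lee_wpmul2l ?lee_fin ?exprn_ge0 ?(ltW c0) //.
by apply: le_hausdorff_weight => x [].
Qed.

Lemma le_hausdorff_outer_image {n p} m (A : set 'rV[R]_n) (B : set 'rV[R]_p)
    (f : 'rV[R]_n -> 'rV[R]_p) : B `<=` f @` A ->
  (forall x y, A x -> A y -> (enorm (f x - f y) <= enorm (x - y))%R) ->
  hausdorff_outer m B <= hausdorff_outer m A.
Proof.
move=> BA lip; apply: le_trans (le_hausdorff_outer _ BA) _.
rewrite -[leRHS]mul1e -(expr1n R m); apply: hausdorff_outer_lipschitz => // x y.
by rewrite mul1r; exact: lip.
Qed.

Lemma hausdorff_outer_translate {n} m (A : set 'rV[R]_n) v :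
  hausdorff_outer m [set (x + v)%R | x in A] = hausdorff_outer m A.
Proof.
apply/eqP; rewrite eq_le; apply/andP; split.
  by apply: (le_hausdorff_outer_image _ _ _ (fun x => x + v)%R) => // x y _ _; rewrite opprD addrACA subrr addr0.
apply: (le_hausdorff_outer_image _ _ _ (fun x => x - v)%R) => [x Ax|x y _ _].
  by exists (x + v)%R; [exists x|rewrite addrK].
by rewrite opprD addrACA subrr addr0.
Qed.

(** A set of diameter at most d < e cannot meet both A and B, so each member of a cover is charged
    to one of them only. *)
Lemma hausdorff_premeasure_metric {n} m (d e : R) (A B : set 'rV[R]_n) : (d < e)%R ->
  (forall x y, A x -> B y -> (e <= enorm (x - y))%R) ->
  hausdorff_premeasure m d A + hausdorff_premeasure m d B <=
  hausdorff_premeasure m d (A `|` B).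
Proof.
move=> de sepAB; apply: le_ereal_inf_tmp => _ [F [ABF dF] <-].
apply: (@le_trans _ _ (\sum_(i <oo) (hausdorff_weight m (F i `&` A) +
    hausdorff_weight m (F i `&` B)))).
  rewrite nneseriesD; try by move=> *; exact: hausdorff_weight_ge0.
  apply: leeD; apply: ereal_inf_lbound; eexists; try reflexivity.
    split=> [x Ax|i]; first by have [i _ Fx] := ABF x (or_introl Ax); exists i.
    apply/ediam_leP => x y [Fx _] [Fy _]; exact: (ediam_leP _ _).2 (dF i) _ _ Fx Fy.
  split=> [x Ax|i]; first by have [i _ Fx] := ABF x (or_intror Ax); exists i.
  apply/ediam_leP => x y [Fx _] [Fy _]; exact: (ediam_leP _ _).2 (dF i) _ _ Fx Fy.
apply: lee_nneseries => i _ => [_|].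
  by rewrite adde_ge0 ?hausdorff_weight_ge0.
have [->|/set0P[x [Fx Ax]]] := eqVneq (F i `&` A) set0.
  by rewrite hausdorff_weight0 add0e le_hausdorff_weight // => y [].
have [->|/set0P[y [Fy By]]] := eqVneq (F i `&` B) set0.
  by rewrite hausdorff_weight0 adde0 le_hausdorff_weight // => y [].
have := (ediam_leP _ _).2 (dF i) x y Fx Fy.
by rewrite lee_fin leNgt (lt_le_trans de (sepAB _ _ Ax By)).
Qed.

Lemma le_hausdorff_premeasure_delta {n} m (d e : R) (A : set 'rV[R]_n) : (d <= e)%R ->
  hausdorff_premeasure m e A <= hausdorff_premeasure m d A.
Proof.
move=> de; apply: ereal_inf_le_tmp => _ [F [AF dF] <-]; exists F => //; split=> // i.
by rewrite (le_trans (dF i)) // lee_fin.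
Qed.

(** The suprema over the scales of A and of B are taken one after the other, moving the other term
    across the inequality; this needs finite values, hence the initial case distinction. *)
Lemma hausdorff_outer_metric {n} m (e : R) (A B : set 'rV[R]_n) : (0 < e)%R ->
  (forall x y, A x -> B y -> (e <= enorm (x - y))%R) ->
  hausdorff_outer m A + hausdorff_outer m B <= hausdorff_outer m (A `|` B).
Proof.
move=> e0 sepAB.
have [->|AB] := eqVneq (hausdorff_outer m (A `|` B)) +oo; first by rewrite leey.
have fin (C : set 'rV[R]_n) : C `<=` A `|` B -> hausdorff_outer m C \is a fin_num.
  move=> CAB; rewrite ge0_fin_numE ?hausdorff_outer_ge0 //.
  by rewrite (le_lt_trans (le_hausdorff_outer m CAB)) // ltey.
have key (d d' : R) : (0 < d)%R -> (0 < d')%R ->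
    hausdorff_premeasure m d A + hausdorff_premeasure m d' B <= hausdorff_outer m (A `|` B).
  (* A common scale: refining increases both premeasures, and e / 2 keeps it strictly below the
     separation. *)
  move=> d0 d'0; pose d1 := Num.min (Num.min d d') (e / 2)%R.
  have d10 : (0 < d1)%R by rewrite !lt_min d0 d'0 divr_gt0.
  apply: (@le_trans _ _ (hausdorff_premeasure m d1 (A `|` B))); last first.
    by apply: ereal_sup_ubound; exists d1.
  apply: le_trans (hausdorff_premeasure_metric _ _ e _ _ _ sepAB); last first.
    by rewrite gt_min ltr_pdivrMr // ltr_pMr // ltr1n orbT.
  by apply: leeD; apply: le_hausdorff_premeasure_delta; rewrite !ge_min lexx ?orbT.
have step (d : R) : (0 < d)%R ->
    hausdorff_premeasure m d A + hausdorff_outer m B <= hausdorff_outer m (A `|` B).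
  move=> d0; have Afin : hausdorff_premeasure m d A \is a fin_num.
    rewrite ge0_fin_numE ?hausdorff_premeasure_ge0 //.
    apply: (@le_lt_trans _ _ (hausdorff_outer m A)).
      by apply: ereal_sup_ubound; exists d.
    by rewrite -ge0_fin_numE ?hausdorff_outer_ge0 ?fin //; left.
  rewrite addeC -leeBrDr //; apply: ge_ereal_sup => _ [d' d'0 <-].
  by rewrite leeBrDr // addeC key.
rewrite -leeBrDr; last by apply: fin; right.
apply: ge_ereal_sup => _ [d d0 <-].
by rewrite leeBrDr ?step // fin //; right.
Qed.

End Hausdorff.

(** * Caratheodory measurability of sublevel sets of Lipschitz functions *)

Section Caratheodory.
Context {R : realType} {n m : nat}.
Variable f : 'rV[R]_n -> R.
Hypothesis lipf : forall x y, `|f x - f y| <= enorm (x - y).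
Local Open Scope ereal_scope.

Lemma hausdorff_outer_separated (A B : set 'rV[R]_n) (a b : R) : (a < b)%R ->
  (forall x, A x -> (f x <= a)%R) -> (forall x, B x -> (b <= f x)%R) ->
  hausdorff_outer m A + hausdorff_outer m B <= hausdorff_outer m (A `|` B).
Proof.
move=> ab Aa Bb; apply: (hausdorff_outer_metric m (b - a)%R); first by rewrite subr_gt0.
move=> x y /Aa fx /Bb fy; apply: le_trans (lipf _ _).
by rewrite distrC (le_trans _ (ler_norm _)) // lerB.
Qed.

(* The complement of the sublevel set is exhausted by the sets
   [c + 1/(j+1) <= f], which are separated from it; the shells
   [c + 1/(i+2) <= f < c + 1/(i+1)] with indices of the same parity are mutually
   separated, so their measures are summable. *)
Lemma lipschitz_sublevel_caratheodory (c : R) :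
  (hausdorff_outer_measure R n m).-caratheodory [set x | (f x <= c)%R].
Proof.
apply: le_caratheodory_measurable => X; change (hausdorff_outer m (X `&` [set x | (f x <= c)%R]) +
  hausdorff_outer m (X `&` ~` [set x | (f x <= c)%R]) <= hausdorff_outer m X).
set C := [set x | _].
have [->|Xoo] := eqVneq (hausdorff_outer m X) +oo; first by rewrite leey.
pose b (i : nat) : R := (c + i.+1%:R^-1)%R.
have bS i : (b i.+1 < b i)%R by rewrite ltrD2l ltf_pV2 ?posrE // ltr_nat.
have bc i : (c < b i)%R by rewrite ltrDl.
pose A i := X `&` [set x | (b i <= f x)%R].
pose D i := A i.+1 `&` [set x | (f x < b i)%R].
pose mu := (@hausdorff_outer R n m).
have mu_ge0 S : 0 <= mu S by exact: hausdorff_outer_ge0.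
have mule S T : S `<=` T -> mu S <= mu T by exact: le_hausdorff_outer.
(* Both parities are handled by one induction: [D N.+1] is separated from [A N], and their union
   lies in [A N.+2], so the two terms on the right advance alternately. *)
have sumD N : (\sum_(i < N.+1) mu (D i) <= mu (A N.+1) + mu (A N))%E.
  elim: N => [|N IH].
    rewrite big_ord_recl big_ord0 adde0 (@le_trans _ _ (mu (A 1%N))) ?leeDl //.
    by apply: mule => x [].
  rewrite big_ord_recr /= (le_trans (leeD2r _ IH)) // -addeA (addeC (mu (A N.+2))).
  rewrite leeD2l // addeC.
  apply: le_trans (hausdorff_outer_separated _ _ _ _ (bS N) _ _) _.
  - by move=> x [_ /ltW].
  - by move=> x [].
  - apply: mule => x [[]//|[Xx bx]]; split=> //; apply: le_trans bx.
    by rewrite ltW // (lt_trans (bS _)).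
have sumDoo : \sum_(0 <= i <oo) mu (D i) < +oo.
  apply: (@le_lt_trans _ _ (mu X + mu X)); last by rewrite lte_add_pinfty // ltey.
  apply: lime_le; first by apply: is_cvg_nneseries => *.
  apply: nearW => N; rewrite big_mkord; case: N => [|N].
    by rewrite big_ord0 adde_ge0.
  by rewrite (le_trans (sumD N)) // leeD // mule // => x [].
have tail0 := nneseries_tail_cvg sumDoo (fun k _ => mu_ge0 (D k)).
(* It is enough to prove the inequality with the tail of the convergent shell series as an error. *)
have cvX : mu X + \sum_(j <= i <oo) mu (D i) @[j --> \oo] --> mu X.
  rewrite -[X in _ --> X]adde0; apply: cvgeD => //; last exact: cvg_cst.
  by rewrite ge0_adde_def // inE.
rewrite -[leRHS](cvg_lim _ cvX) //; apply: lime_ge; first by apply/cvg_ex; exists (mu X).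
apply: nearW => j.
apply: (@le_trans _ _ (mu (X `&` C) + (mu (A j) + \sum_(j <= i <oo) mu (D i)))).
  rewrite leeD2l //.
  apply: (@le_trans _ _ (mu (A j `|` \bigcup_i D (i + j)%N))).
    apply: mule => x [Xx /negP]; rewrite -ltNge => cx.
    have [bx|xb] := leP (b j) (f x); [by left|right].
    (* The least such index names the shell containing x; for index 0 the upper bound of the shell
       is the assumption f x < b j. *)
    have ex : exists i, (b (i + j).+1 <= f x)%R.
      have [k ck] := ltr_add_invr cx; exists k; apply: ltW; apply: lt_trans ck.
      by rewrite ltrD2l ltf_pV2 ?posrE // ltr_nat ltnS leq_addr.
    case: (ex_minnP ex) => i bi mini; exists i => //; split; first by split.
    case: i bi mini => [//|i] bi mini /=; rewrite ltNge; apply/negP => h.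
    by have := mini i h; rewrite ltnn.
  apply: le_trans (outer_measureU2 (hausdorff_outer_measure R n m) _ _) _.
  rewrite leeD2l //.
  apply: le_trans (outer_measure_sigma_subadditive (hausdorff_outer_measure R n m) _) _.
  by rewrite -nneseries_addn // => i; exact: mu_ge0.
rewrite addeA leeD2r //.
apply: le_trans (hausdorff_outer_separated _ _ _ _ (bc j) _ _) _.
- by move=> x [].
- by move=> x [].
- by apply: mule => x [[]|[]].
Qed.

End Caratheodory.

(** * Hausdorff measure of cubes and spheres *)

Section Cubes.
Context {R : realType}.

Lemma unit_ball_volume_gt0 m : 0 < unit_ball_volume R m.
Proof.
suff : 0 < unit_ball_volume R m /\ 0 < unit_ball_volume R m.+1 by case.
elim: m => [|m [IH1 IH2]]; first by split; rewrite /= ?ltr01 ?ltr0n.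
by split=> //; rewrite [unit_ball_volume _ _.+2]/= mulr_gt0 // divr_gt0 // mulr_gt0 // pi_gt0.
Qed.

(** The family is continued by empty sets, of diameter -oo and, in every dimension m, of weight
    0. *)
Lemma hausdorff_premeasure_finite_cover {n} m (T : finType) (X : T -> set 'rV[R]_n)
    (A : set 'rV[R]_n) (d : R) : (forall x, A x -> exists t, X t x) ->
  (forall t, ediam (X t) <= d%:E)%E ->
  (hausdorff_premeasure m d A <= \sum_(t : T) hausdorff_weight m (X t))%E.
Proof.
move=> AX dX.
pose F (i : nat) := if insub i is Some j then X (@enum_val T predT j) else set0.
apply: (@le_trans _ _ (\sum_(i <oo) hausdorff_weight m (F i))%E).
  apply: ereal_inf_lbound; exists F => //; split.
    move=> x /AX[t tx]; exists (enum_rank t) => //.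
    by rewrite /F insubT // => lt; rewrite (_ : Sub _ _ = enum_rank t) ?enum_rankK //; exact: val_inj.
  move=> i; rewrite /F; case: insubP => [j _ _|_]; first exact: dX.
  by rewrite ediam_set0 leNye.
rewrite (nneseries_split 0 #|T|); last by move=> *; exact: hausdorff_weight_ge0.
rewrite eseries0 ?adde0; last first.
  move=> i; rewrite add0n => iT _; rewrite /F insubN ?hausdorff_weight0 // -leqNgt //.
rewrite add0n big_mkord [leRHS]big_enum_val /=.
by apply: lee_sum => i _; rewrite /F valK.
Qed.

Lemma card_ord_le (M : nat) (P : pred 'I_M) (l : R) : 0 <= l ->
  (forall u v, P u -> P v -> v%:R - u%:R <= l) -> #|P|%:R <= l + 1.
Proof.
move=> l0 Pl; have [u0 Pu0|P0] := pickP P; last by rewrite eq_card0 // addr_ge0.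
have [u Pu minu] := arg_minnP (fun u : 'I_M => u : nat) Pu0.
have /andP[lt1 lt2] := truncn_itv l0.
apply: (@le_trans _ _ (Num.trunc l).+1%:R); last by rewrite -natr1 lerD2r.
rewrite ler_nat cardE -(size_map val) -(size_iota u (Num.trunc l).+1).
apply: uniq_leq_size; first by rewrite map_inj_uniq ?enum_uniq //; exact: val_inj.
move=> _ /mapP[v + ->]; rewrite mem_enum => Pv; rewrite mem_iota minu //=.
have := le_lt_trans (Pl _ _ Pu Pv) lt2.
by rewrite ltrBlDr -natrD ltr_nat addnC.
Qed.

(** The set is a product over the coordinates, and two indices admissible in one coordinate differ
    by at most 2 a N. *)
Lemma card_grid_le d (N : nat) (x : 'rV[R]_d) (a : R) : (0 < N)%N -> 0 <= a ->
  #|[pred z : {ffun 'I_d -> 'I_N.+1} | [forall j, `|x ord0 j - (z j)%:R / N%:R| < a]]|%:R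
    <= (2 * a * N%:R + 1) ^+ d.
Proof.
move=> N0 a0; have NR0 : 0 < N%:R :> R by rewrite ltr0n.
pose P (j : 'I_d) := [pred v : 'I_N.+1 | `|x ord0 j - v%:R / N%:R| < a].
rewrite (@eq_card _ _ (mem (family P))); last first.
  move=> z; apply/idP/familyP => [|H]; first by rewrite inE => /forallP H j; rewrite inE H.
  by rewrite inE; apply/forallP => j; have := H j; rewrite inE.
rewrite card_family foldrE big_map big_enum /= natr_prod -[d in leRHS]card_ord -prodr_const.
apply: ler_prod => j _; rewrite ler0n /=; apply: card_ord_le.
  by rewrite !mulr_ge0.
move=> u v /= Pu Pv.
have -> : v%:R - u%:R = (v%:R / N%:R - u%:R / N%:R) * N%:R :> R.
  by field; rewrite gt_eqF.
rewrite ler_pM2r //; move: Pu Pv; rewrite !ltr_norml => /andP[? ?] /andP[? ?]; lra.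
Qed.

(** Any point of A serves as centre, with the diameter as radius. For empty A the radius 0 costs
    nothing because m > 0. *)
Lemma hausdorff_weight_enclosed {n} m (A : set 'rV[R]_n) : (0 < m)%N ->
  (ediam A < +oo)%E ->
  exists e : R, exists x : 'rV[R]_n, [/\ 0 <= e,
    forall y, A y -> enorm (x - y) <= e &
    ((unit_ball_volume R m / 2 ^+ m * e ^+ m)%:E <= hausdorff_weight m A)%E].
Proof.
move=> m0 Afin; have [->|A0] := eqVneq A set0.
  exists 0, 0; split => //.
  by rewrite expr0n eqn0Ngt m0 mulr0 hausdorff_weight_ge0.
have /set0P[x Ax] := A0; have ge0 := ediam_ge0 (ex_intro _ x Ax).
have fin : ediam A \is a fin_num by rewrite ge0_fin_numE.
exists (fine (ediam A)), x; split; first exact: fine_ge0.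
  by move=> y Ay; rewrite -lee_fin fineK //; exact: (ediam_leP _ _).2.
by rewrite /hausdorff_weight (negbTE A0) EFinM EFin_expe fineK.
Qed.

Lemma coord_le_mx_norm {n} (x : 'rV[R]_n) i : `|x ord0 i| <= `|x|.
Proof.
by rewrite [leRHS]/Num.norm /= mx_normrE; apply/bigmax_geP; right => /=; exists (ord0, i).
Qed.

Definition unit_cube d : set 'rV[R]_d := [set y | forall i, 0 <= y ord0 i <= 1].

Lemma compact_unit_cube d : compact (@unit_cube d).
Proof.
have := @rV_compact R d (fun=> `[0, 1]%classic) (fun=> @segment_compact R 0 1).
by congr compact; apply/seteqP; split=> y H i; have := H i; rewrite /= in_itv.
Qed.

(** A volume comparison by counting: the cube holds (N + 1)^d points of the grid of mesh 1/N, and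
    the i-th small cube at most (2 a_i N + 1)^d <= (4 a_i N)^d of them. *)
Lemma unit_cube_ball_cover d (M : nat) (x : 'I_M -> 'rV[R]_d) (a : 'I_M -> R) :
  (forall i, 0 < a i) ->
  (forall y, unit_cube d y -> exists i, forall j, `|x i ord0 j - y ord0 j| < a i) ->
  1 <= 4 ^+ d * \sum_i a i ^+ d.
Proof.
move=> a0 cover.
(* Fine enough that 2 a_i N >= 1 for every i, which absorbs the extra 1 in the count. *)
pose N := (\max_(i < M) (Num.trunc (2 * a i)^-1).+1).+1.
have N0 : 0 < N%:R :> R by rewrite ltr0n.
have aN i : 1 <= 2 * a i * N%:R.
  rewrite mulrC -ler_pdivrMr ?mulr_gt0 // div1r.
  have a2 : 0 < (2 * a i)^-1 by rewrite invr_gt0 mulr_gt0.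
  have /andP[_ /ltW/le_trans] := truncn_itv (ltW a2); apply.
  rewrite ler_nat /N; apply: leqW.
  exact: (leq_bigmax (F := fun i => (Num.trunc (2 * a i)^-1).+1) i).
pose G i := [pred z : {ffun 'I_d -> 'I_N.+1} |
  [forall j, `|x i ord0 j - (z j)%:R / N%:R| < a i]].
have cardG : (#|{ffun 'I_d -> 'I_N.+1}| <= \sum_i #|G i|)%N.
  rewrite -sum1_card (eq_bigr (fun i => \sum_z (G i z : nat))%N); last first.
    by move=> i _; rewrite -sum1_card big_mkcond.
  rewrite exchange_big /=; apply: leq_sum => z _.
  have [|i Gi] := cover (\row_j ((z j)%:R / N%:R)).
    move=> j; rewrite mxE divr_ge0 //= ler_pdivrMr // mul1r ler_nat.
    by rewrite -ltnS.
  rewrite (bigD1 i) //=; suff -> : [forall j, `|x i ord0 j - (z j)%:R / N%:R| < a i] by [].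
  by apply/forallP => j; have := Gi j; rewrite mxE.
rewrite -(ler_pM2l (exprn_gt0 d N0)) mulr1.
apply: (@le_trans _ _ (N.+1%:R ^+ d)).
  by rewrite lerXn2r ?nnegrE ?ler0n // ler_nat.
apply: (@le_trans _ _ (\sum_i #|G i|%:R)).
  by rewrite -natr_sum -natrX ler_nat (leq_trans _ cardG) // card_ffun !card_ord.
rewrite !mulr_sumr; apply: ler_sum => i _.
apply: le_trans (card_grid_le d N (x i) (a i) isT (ltW (a0 i))) _.
rewrite -!exprMn lerXn2r ?nnegrE ?addr_ge0 ?mulr_ge0 ?(ltW (a0 i)) //.
have -> : N%:R * (4 * a i) = 2 * (2 * a i * N%:R) by ring.
by have := aN i; lra.
Qed.

(* A cover of the cube by sets of small total weight is fattened to an open cover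
   by cubes, of which finitely many suffice by compactness; these must contain all
   the points of a fine grid, and there are too many of them. *)
Lemma hausdorff_outer_unit_cube_gt0 d : (0 < d)%N ->
  (0 < hausdorff_outer d (@unit_cube d))%E.
Proof.
move=> d0; pose C : R := unit_ball_volume R d / 2 ^+ d.
have C0 : 0 < C by rewrite divr_gt0 ?unit_ball_volume_gt0 ?exprn_gt0.
(* Fattened covers have total at least C / 4^d = 2 kappa, and the fattening adds at most the sum of
   the kappa / 2^(i+1), which is kappa. *)
pose kappa := C / 4 ^+ d / 2.
have k0 : 0 < kappa by apply: divr_gt0 => //; apply: divr_gt0 => //; exact: exprn_gt0.
have kE : (0 < kappa%:E)%E by rewrite lte_fin.
apply: (lt_le_trans kE).
apply: (@le_trans _ _ (hausdorff_premeasure d 1 (@unit_cube d))); last first.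
  by apply: ereal_sup_ubound; exists 1 => //=.
apply: le_ereal_inf_tmp => _ [F [cF dF] <-].
have tau0 i : 0 < kappa / (2 ^ i.+1)%:R by rewrite divr_gt0 // ltr0n expn_gt0.
(* A radius slightly larger than the enclosing one makes the inclusion strict, hence the balls open;
   continuity of the power bounds the added weight. *)
have enc i : exists p : R * 'rV[R]_d, [/\ 0 < p.1,
    forall y, F i y -> enorm (p.2 - y) < p.1 &
    ((C * p.1 ^+ d)%:E <= hausdorff_weight d (F i) + (kappa / (2 ^ i.+1)%:R)%:E)%E].
  have [e [x [e0 Fe we]]] := hausdorff_weight_enclosed d _ d0 (le_lt_trans (dF i) (ltry _)).
  have cvf : (fun a : R => C * a ^+ d) @ e --> C * e ^+ d.
    by apply: cvgM; [exact: cvg_cst|exact: exprn_continuous].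
  have [a [ea Ca]] : exists a, e < a /\ C * a ^+ d <= C * e ^+ d + kappa / (2 ^ i.+1)%:R.
    have /cvgrPdist_le/(_ _ (tau0 i)) [r /= r0 H] := cvf.
    exists (e + r / 2); split; first by rewrite ltrDl divr_gt0.
    have := H (e + r / 2); rewrite /ball_ /= opprD addrA subrr add0r normrN.
    rewrite gtr0_norm ?divr_gt0 // ltr_pdivrMr // ltr_pMr // ltr1n => /(_ isT).
    by rewrite distrC => /(le_trans (ler_norm _)); rewrite lerBlDl.
  exists (a, x); split => /=; first exact: le_lt_trans ea.
    by move=> y /Fe /le_lt_trans; apply.
  by apply: le_trans (leeD2r _ we); rewrite -EFinD lee_fin.
have [p Pp] := choice enc.
have := compact_unit_cube d.
rewrite compact_cover => /(_ nat setT (fun i => ball (p i).2 (p i).1)) [].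
- by move=> i _; exact: ball_open.
- move=> y /cF[i _ Fy]; exists i => //; have [p0 /(_ _ Fy) xy _] := Pp i.
  rewrite -ball_normE /ball_ /=; apply: le_lt_trans xy.
  rewrite /Num.norm /= mx_normrE; apply/bigmax_leP; split; first exact: enorm_ge0.
  by move=> [r j] _ /=; rewrite ord1 coord_le_enorm.
move=> D' _ cD.
(* An initial segment of indices containing the finite subcover; the additional balls do no harm. *)
pose M := (\max_(i <- finmap.enum_fset D') i).+1.
have H : 1 <= 4 ^+ d * \sum_(i < M) (p i).1 ^+ d.
  apply: (unit_cube_ball_cover d M (fun i => (p i).2)) => [i|y /cD[i /= iD]]; first by have [] := Pp i.
  rewrite -ball_normE /ball_ /= => xy.
  have iM : (i < M)%N by rewrite ltnS; apply: (leq_bigmax_seq (F := id)).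
  exists (Ordinal iM) => j /=; apply: le_lt_trans xy.
  by have := coord_le_mx_norm ((p i).2 - y) j; rewrite !mxE.
have sumle : ((C * \sum_(i < M) (p i).1 ^+ d)%:E <=
    \sum_(i <oo) hausdorff_weight d (F i) + kappa%:E)%E.
  apply: le_trans (epsilon_trick xpredT _ (ltW k0)); last by move=> i; exact: hausdorff_weight_ge0.
  apply: le_trans (nneseries_lim_ge M _); last first.
    by move=> i _ _; rewrite adde_ge0 ?hausdorff_weight_ge0 // lee_fin ltW.
  rewrite mulr_sumr -sumEFin big_mkord; apply: lee_sum => i _.
  by have [] := Pp i.
rewrite -(@leeD2rE _ kappa%:E) //; apply: le_trans sumle.
rewrite -EFinD lee_fin -splitr ler_pdivrMr ?exprn_gt0 // -mulrA -[leLHS]mulr1.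
by rewrite ler_pM2l // mulrC.
Qed.

End Cubes.

(** * Finiteness of the measures of the cube and of the sphere *)

Section SphereFinite.
Context {R : realType}.

Lemma outer_measure_fin_cover {T : Type} (mu : {outer_measure set T -> \bar R})
    (I : finType) (X : I -> set T) (A : set T) : (forall x, A x -> exists t, X t x) ->
  (mu A <= \sum_(t : I) mu (X t))%E.
Proof.
move=> AX; apply: (@le_trans _ _ (mu (\big[setU/set0]_(t : I) X t))).
  apply: le_outer_measure => x /AX[t Xt]; rewrite -bigcup_seq.
  by exists t => //=; rewrite mem_index_enum.
apply: (big_ind2 (fun B s => mu B <= s)%E) => [|B s B' s' Bs Bs'|//].
  by rewrite outer_measure0.
by apply: le_trans (outer_measureU2 _ _ _) _; exact: leeD.
Qed.

Lemma hausdorff_weight_le {n} m (A : set 'rV[R]_n) (a : R) : 0 <= a ->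
  (ediam A <= a%:E)%E ->
  (hausdorff_weight m A <= (unit_ball_volume R m / 2 ^+ m * a ^+ m)%:E)%E.
Proof.
move=> a0 Aa; have C0 : 0 <= unit_ball_volume R m / 2 ^+ m.
  by rewrite divr_ge0 ?unit_ball_volume_ge0 ?exprn_ge0.
have [->|A0] := eqVneq A set0.
  by rewrite hausdorff_weight0 lee_fin mulr_ge0 ?exprn_ge0.
rewrite /hausdorff_weight (negbTE A0) [leRHS]EFinM EFin_expe lee_wpmul2l ?lee_fin //.
by apply: lee_expe => //; exact/ediam_ge0/set0P.
Qed.

Lemma grid_interval (N : nat) (t : R) : 0 <= t <= 1 ->
  exists z : 'I_N.+1, z%:R / N.+1%:R <= t <= z.+1%:R / N.+1%:R.
Proof.
move=> /andP[t0 t1]; have N0 : 0 < N.+1%:R :> R by rewrite ltr0n.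
have /truncn_itv/andP[lt1 lt2] : 0 <= t * N.+1%:R by rewrite mulr_ge0.
have [zN|Nz] := ltnP (Num.trunc (t * N.+1%:R)) N.+1.
  exists (Ordinal zN) => /=.
  by rewrite ler_pdivrMr // ler_pdivlMr // lt1 ltW.
(* The endpoint t = 1, whose integer part points past the last cell. *)
exists ord_max => /=; rewrite ler_pdivrMr // mulfV ?gt_eqF // t1 andbT.
by apply: le_trans lt1; rewrite ler_nat ltnW.
Qed.

(** A subdivision into (N + 1)^d cubes of diameter at most d / (N + 1) has a total weight bounded
    independently of N. *)
Lemma hausdorff_outer_unit_cube_lty d :
  (hausdorff_outer d (@unit_cube R d) < +oo)%E.
Proof.
pose C := unit_ball_volume R d / 2 ^+ d * d%:R ^+ d.
apply: (@le_lt_trans _ _ C%:E); last exact: ltry.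
apply: ge_ereal_sup => _ [del /= del0 <-].
pose N := Num.trunc (d%:R / del).
have N0 : 0 < N.+1%:R :> R by rewrite ltr0n.
have Ndel : d%:R * N.+1%:R^-1 <= del.
  rewrite ler_pdivrMr // mulrC -ler_pdivrMr // ltW //.
  by have /truncn_itv/andP[] : 0 <= d%:R / del by rewrite divr_ge0 // ltW.
pose X (z : {ffun 'I_d -> 'I_N.+1}) :=
  [set y : 'rV[R]_d | forall j, (z j)%:R / N.+1%:R <= y ord0 j <= (z j).+1%:R / N.+1%:R].
have dX z : (ediam (X z) <= (d%:R * N.+1%:R^-1)%:E)%E.
  apply/ediam_leP => x y Xx Xy; rewrite lee_fin.
  apply: enorm_le_coord => // i; rewrite !mxE ler_norml.
  have := Xx i; have := Xy i; rewrite -[(z i).+1%:R]natr1 !mulrDl mul1r.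
  set e : R := N.+1%:R^-1; set a : R := _%:R * e.
  move: a => a; move: e => e /andP[? ?] /andP[? ?].
  by apply/andP; split; lra.
apply: (@le_trans _ _ (\sum_z hausdorff_weight d (X z))%E).
  apply: hausdorff_premeasure_finite_cover => [y Qy|z].
    have [z zP] := choice (fun j => grid_interval N _ (Qy j)).
    by exists [ffun j => z j] => j; rewrite ffunE.
  by apply: le_trans (dX z) _; rewrite lee_fin.
apply: (@le_trans _ _ (\sum_(z : {ffun 'I_d -> 'I_N.+1})
    (unit_ball_volume R d / 2 ^+ d * (d%:R * N.+1%:R^-1) ^+ d)%:E)%E).
  apply: lee_sum => z _; apply: hausdorff_weight_le (dX z).
  by rewrite mulr_ge0.
rewrite sumEFin lee_fin sumr_const card_ffun !card_ord exprMn -[leLHS]mulr_natr natrX exprVn /C.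
by rewrite -!mulrA mulVf ?mulr1 // expf_neq0 // gt_eqF.
Qed.

Section face.
Context {d : nat}.

(* The unit cube parametrizes the face [x_i = 1] of the cube [-1,1]^(d+1). *)
Definition face_chart (i : 'I_d.+1) (y : 'rV[R]_d) : 'rV[R]_d.+1 :=
  \row_l if unlift i l is Some j then 2 * y ord0 j - 1 else 1.

Lemma face_chart_lipschitz i y y' :
  enorm (face_chart i y - face_chart i y') <= 2 * enorm (y - y').
Proof.
rewrite enorm_le ?mulr_ge0 ?enorm_ge0 // exprMn enorm_sqr /dotp (bigD1_ord i) //=.
rewrite !mxE unlift_none subrr mul0r add0r mulr_sumr.
by apply: ler_sum => j _; rewrite !mxE liftK; lra.
Qed.

Lemma face_chart_ge1 i y : 1 <= enorm (face_chart i y).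
Proof.
apply: le_trans (coord_le_enorm _ i); rewrite mxE unlift_none normr1 //.
Qed.

(** Central projection to the sphere of a face of the cube [-1,1]^(d+1); [t.2] selects between
    opposite faces. *)
Definition sphere_chart (t : 'I_d.+1 * bool) (y : 'rV[R]_d) : 'rV[R]_d.+1 :=
  (-1) ^+ t.2 *: ((enorm (face_chart t.1 y))^-1 *: face_chart t.1 y).

Lemma sphere_chart_cover u : unit_sphere R d.+1 u ->
  exists t, (sphere_chart t @` @unit_cube R d) u.
Proof.
move=> u1; pose i := [arg max_(i > (ord0 : 'I_d.+1)) `|u ord0 i|]%O.
have imax j : `|u ord0 j| <= `|u ord0 i|.
  by rewrite /i; case: arg_maxP => // l _; apply.
have ui0 : u ord0 i != 0.
  apply/eqP => ui; have /eqP : u = 0.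
    apply/rowP => j; rewrite mxE; apply/eqP; rewrite -normr_le0.
    by rewrite (le_trans (imax j)) // ui normr0.
  by apply/negP/eqP => u0; move: u1; rewrite /unit_sphere /= u0 enorm0 => /esym/eqP; rewrite oner_eq0.
(* Dividing u by its coordinate of largest modulus lands on the face x_i = 1; y solves 2 y_j - 1 =
   u_l / u_i with l = lift i j. *)
pose y : 'rV[R]_d := \row_j ((u ord0 (lift i j) / u ord0 i + 1) / 2).
have yE : face_chart i y = (u ord0 i)^-1 *: u.
  apply/rowP => l; rewrite !mxE; case: unliftP => [j ->|->]; last by rewrite mulVf.
  by rewrite mxE mulrC divfK // addrK mulrC.
exists (i, u ord0 i < 0); exists y => [j|].
  rewrite mxE; have : `|u ord0 (lift i j) / u ord0 i| <= 1.
    by rewrite normrM normfV ler_pdivrMr ?normr_gt0 // mul1r.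
  by rewrite ler_norml => /andP[? ?]; apply/andP; split; lra.
rewrite /sphere_chart /= yE enormZ u1 mulr1 normfV invrK !scalerA.
by rewrite mulrA -numEsign divff ?scale1r.
Qed.

End face.

(** Each of the finitely many charts is 2-Lipschitz: the faces lie outside the open unit ball, where
    normalization is 1-Lipschitz. *)
Lemma hausdorff_outer_sphere_lty d :
  (hausdorff_outer d (unit_sphere R d.+1) < +oo)%E.
Proof.
apply: le_lt_trans (outer_measure_fin_cover (hausdorff_outer_measure R d.+1 d) _
  (fun t => sphere_chart t @` @unit_cube R d) _ sphere_chart_cover) _.
apply: lte_sum_pinfty => t _.
have : (hausdorff_outer d (sphere_chart t @` @unit_cube R d) <=
    (2 ^+ d)%:E * hausdorff_outer d (@unit_cube R d))%E.
  apply: hausdorff_outer_lipschitz => // x y _ _.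
  rewrite /sphere_chart -scalerBr enormZ normrX normrN1 expr1n mul1r.
  apply: le_trans (face_chart_lipschitz t.1 x y); rewrite -[leRHS]mul1r -[X in X * _]invr1.
  by apply: normalize_lipschitz => //; exact: face_chart_ge1.
move=> /le_lt_trans; apply; apply: lte_mul_pinfty => //.
exact: hausdorff_outer_unit_cube_lty.
Qed.

End SphereFinite.

(** * Bands around a subsphere *)

Section HeadTail.
Context {R : realType} {n : nat} (k : nat).
Implicit Types x y : 'rV[R]_n.

(** The two blocks stay in R^n, padded by zeros, so that they can be added and no dimension casts
    arise. *)
Definition headp x : 'rV[R]_n := \row_i if (i < k)%N then x ord0 i else 0.
Definition tailp x : 'rV[R]_n := \row_i if (i < k)%N then 0 else x ord0 i.
Definition tail_norm x : R := \big[Num.max/0]_(i < n | (k <= i)%N) `|x ord0 i|.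

Lemma headDtail x : headp x + tailp x = x.
Proof. by apply/rowP => i; rewrite !mxE; case: ifP; rewrite ?addr0 ?add0r. Qed.

Lemma headpD x y : headp (x + y) = headp x + headp y.
Proof. by apply/rowP => i; rewrite !mxE; case: ifP; rewrite ?addr0. Qed.

Lemma headpZ a x : headp (a *: x) = a *: headp x.
Proof. by apply/rowP => i; rewrite !mxE; case: ifP; rewrite ?mulr0. Qed.

Lemma headpB x y : headp (x - y) = headp x - headp y.
Proof. by rewrite headpD -scaleN1r headpZ scaleN1r. Qed.

Lemma tailpB x y : tailp (x - y) = tailp x - tailp y.
Proof. by apply/rowP => i; rewrite !mxE; case: ifP; rewrite ?subr0. Qed.

Lemma headp_headp x : headp (headp x) = headp x.
Proof. by apply/rowP => i; rewrite !mxE; case: (i < k)%N. Qed.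

Lemma headp_tailp x : headp (tailp x) = 0.
Proof. by apply/rowP => i; rewrite !mxE; case: (i < k)%N. Qed.

Lemma tailp_tailp x : tailp (tailp x) = tailp x.
Proof. by apply/rowP => i; rewrite !mxE; case: (i < k)%N. Qed.

Lemma tailp_headp x : tailp (headp x) = 0.
Proof. by apply/rowP => i; rewrite !mxE; case: (i < k)%N. Qed.

Lemma tailpD x y : tailp (x + y) = tailp x + tailp y.
Proof. by apply/rowP => i; rewrite !mxE; case: ifP; rewrite ?addr0. Qed.

Lemma tailpZ a x : tailp (a *: x) = a *: tailp x.
Proof. by apply/rowP => i; rewrite !mxE; case: ifP; rewrite ?mulr0. Qed.

Lemma enorm_head_tail x : enorm x ^+ 2 = enorm (headp x) ^+ 2 + enorm (tailp x) ^+ 2.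
Proof.
rewrite !enorm_sqr -big_split; apply: eq_bigr => i _; rewrite !mxE /=.
by case: ifP; rewrite mul0r ?addr0 ?add0r.
Qed.

Lemma enorm_head_le x : enorm (headp x) <= enorm x.
Proof. by apply: le_enorm => i; rewrite !mxE; case: ifP; rewrite ?normr0. Qed.

Lemma enorm_tail_le x : enorm (tailp x) <= enorm x.
Proof. by apply: le_enorm => i; rewrite !mxE; case: ifP; rewrite ?normr0. Qed.

Lemma ler_dist_enorm x y : `|enorm x - enorm y| <= enorm (x - y).
Proof.
rewrite ler_norml; apply/andP; split.
  by rewrite lerNl opprB lerBlDr (enormB x y) (le_trans _ (ler_enormD _ _)) // subrK.
by rewrite lerBlDr (le_trans _ (ler_enormD _ _)) // subrK.
Qed.

Lemma enorm_head_lipschitz x y : `|enorm (headp x) - enorm (headp y)| <= enorm (x - y).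
Proof. by apply: le_trans (ler_dist_enorm _ _) _; rewrite -headpB enorm_head_le. Qed.

Lemma tail_norm_ge0 x : 0 <= tail_norm x.
Proof. exact: bigmax_ge_id. Qed.

Lemma tail_norm_leP x s : 0 <= s ->
  (forall i : 'I_n, (k <= i)%N -> `|x ord0 i| <= s) <-> tail_norm x <= s.
Proof.
by move=> s0; split=> [H|/bigmax_leP[_]//]; apply/bigmax_leP.
Qed.

Lemma coord_le_tail_norm x (i : 'I_n) : (k <= i)%N -> `|x ord0 i| <= tail_norm x.
Proof. exact: (tail_norm_leP x _ (tail_norm_ge0 x)).2. Qed.

Lemma tail_norm_lipschitz x y : `|tail_norm x - tail_norm y| <= enorm (x - y).
Proof.
suff H a b : tail_norm a <= tail_norm b + enorm (a - b).
  have := H x y; have := H y x; rewrite (enormB y) ler_norml => ? ?.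
  by apply/andP; split; lra.
apply/tail_norm_leP; first by rewrite addr_ge0 ?tail_norm_ge0 ?enorm_ge0.
move=> i ki; rewrite -[a ord0 i](subrK (b ord0 i)) addrC.
apply: le_trans (ler_normD _ _) _; apply: lerD; first exact: coord_le_tail_norm.
by have := coord_le_enorm (a - b) i; rewrite !mxE.
Qed.

Lemma tail_normZ a x : 0 <= a -> tail_norm (a *: x) = a * tail_norm x.
Proof.
move=> a0; apply/eqP; rewrite eq_le; apply/andP; split.
  apply/tail_norm_leP; first by rewrite mulr_ge0 ?tail_norm_ge0.
  by move=> i ki; rewrite mxE normrM (ger0_norm a0) ler_wpM2l // coord_le_tail_norm.
have [->|an0] := eqVneq a 0; first by rewrite mul0r tail_norm_ge0.
have ap : 0 < a by rewrite lt_neqAle eq_sym an0.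
rewrite -ler_pdivlMl //; apply/tail_norm_leP.
  by rewrite mulr_ge0 ?invr_ge0 ?tail_norm_ge0.
move=> i ki; rewrite ler_pdivlMl //.
by have := coord_le_tail_norm (a *: x) i ki; rewrite mxE normrM (ger0_norm a0).
Qed.

Lemma enorm_tail_le_tail_norm x : enorm (tailp x) <= n%:R * tail_norm x.
Proof.
apply: enorm_le_coord => [|i]; first exact: tail_norm_ge0.
rewrite mxE; case: ltnP => [_|ki]; first by rewrite normr0 tail_norm_ge0.
exact: coord_le_tail_norm.
Qed.

Lemma tail_norm_le_enorm x : tail_norm x <= enorm x.
Proof. by apply/tail_norm_leP; rewrite ?enorm_ge0 // => i _; exact: coord_le_enorm. Qed.

Definition sphere_band (s : R) : set 'rV[R]_n :=
  [set u | unit_sphere R n u /\ tail_norm u <= s].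
Definition cylinder_band (s : R) : set 'rV[R]_n :=
  [set x | enorm (headp x) = 1 /\ tail_norm x <= s].

(** By Pythagoras the squared length of the head is 1 - t^2 with t <= n s <= 1, and 1 - t^2 >= (1 -
    t)^2. *)
Lemma enorm_head_ge u s : unit_sphere R n u -> tail_norm u <= s -> n%:R * s <= 1 ->
  1 - n%:R * s <= enorm (headp u).
Proof.
move=> u1 us ns; have := enorm_head_tail u; rewrite u1 expr1n => E.
have ts : enorm (tailp u) <= n%:R * s.
  by apply: le_trans (enorm_tail_le_tail_norm u) _; rewrite ler_wpM2l.
rewrite -(ler_pXn2r (ltn0Sn 1)) ?nnegrE ?enorm_ge0 ?subr_ge0 //.
have := enorm_ge0 (tailp u); move: E ts ns.
move: (enorm _) (enorm _) (n%:R * s) => a b c; nra.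
Qed.

(** This map and the next keep the tail and rescale only the head; on thin bands they are inverse to
    each other. *)
Definition to_cylinder x := (enorm (headp x))^-1 *: headp x + tailp x.
Definition to_sphere x := Num.sqrt (1 - enorm (tailp x) ^+ 2) *: headp x + tailp x.

Lemma to_cylinder_lipschitz s x y : 0 <= s -> n%:R * s < 1 ->
  sphere_band s x -> sphere_band s y ->
  enorm (to_cylinder x - to_cylinder y) <= (1 - n%:R * s)^-1 * enorm (x - y).
Proof.
move=> s0 ns [x1 xs] [y1 ys]; have r0 : 0 < 1 - n%:R * s by rewrite subr_gt0.
have ns0 : 0 <= n%:R * s by rewrite mulr_ge0.
have Hx := enorm_head_ge x s x1 xs (ltW ns); have Hy := enorm_head_ge y s y1 ys (ltW ns).
rewrite -(ler_pXn2r (ltn0Sn 1)) ?nnegrE ?mulr_ge0 ?enorm_ge0 ?invr_ge0 ?(ltW r0) //.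
rewrite enorm_head_tail headpB tailpB !(headpD, tailpD, headpZ, tailpZ, headp_headp,
  headp_tailp, tailp_tailp, tailp_headp) !scaler0 !addr0 !add0r exprMn
  [X in _ * X]enorm_head_tail mulrDr lerD //.
  rewrite headpB -exprMn lerXn2r ?nnegrE ?enorm_ge0 ?mulr_ge0 ?enorm_ge0 ?invr_ge0 ?(ltW r0) //.
  exact: normalize_lipschitz.
by rewrite tailpB ler_peMl ?sqr_ge0 // exprn_ege1 // invr_ge1 ?unitfE ?gt_eqF // lerBlDr lerDl.
Qed.

(** If p and q are the two roots, |p - q| (p + q) = |a - b| (a + b), where a + b <= 2c and p + q >=
    2 (1 - c). *)
Lemma sqrt_one_minus_sqr_lipschitz (c a b : R) : 0 <= c < 1 -> 0 <= a <= c -> 0 <= b <= c ->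
  `|Num.sqrt (1 - a ^+ 2) - Num.sqrt (1 - b ^+ 2)| <= c / (1 - c) * `|a - b|.
Proof.
move=> /andP[c0 c1] /andP[a0 ac] /andP[b0 bc].
have S z : 0 <= z <= c -> 1 - c <= Num.sqrt (1 - z ^+ 2).
  move=> /andP[z0 zc]; have c1' : 0 <= 1 - c by rewrite subr_ge0 ltW.
  by rewrite -(ger0_norm c1') -sqrtr_sqr ler_wsqrtr //; nra.
have := S a; have := S b; rewrite a0 b0 ac bc => /(_ isT) Sb /(_ isT) Sa.
have Ea := sqr_sqrtr (_ : 0 <= 1 - a ^+ 2); have Eb := sqr_sqrtr (_ : 0 <= 1 - b ^+ 2).
have {}Ea : Num.sqrt (1 - a ^+ 2) ^+ 2 = 1 - a ^+ 2 by apply: Ea; nra.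
have {}Eb : Num.sqrt (1 - b ^+ 2) ^+ 2 = 1 - b ^+ 2 by apply: Eb; nra.
move: Sa Sb Ea Eb; move: (Num.sqrt _) (Num.sqrt _) => q p Sa Sb Ea Eb.
have c10 : 0 < 1 - c by rewrite subr_gt0.
have pq : 0 < p + q by lra.
rewrite -(ler_pM2r pq) -[X in `|_| * X](gtr0_norm pq) -normrM -subr_sqr Ea Eb.
have -> : 1 - a ^+ 2 - (1 - b ^+ 2) = (b - a) * (a + b) by ring.
rewrite normrM (distrC b) [leLHS]mulrC [leRHS]mulrAC ler_wpM2r // ger0_norm ?addr_ge0 //.
rewrite mulrAC ler_pdivlMr //; nra.
Qed.

(* [to_sphere x] is [x + (sqrt (1 - |tail x|^2) - 1) head x], a small
   perturbation of the identity. *)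
Lemma to_sphere_lipschitz s x y : 0 <= s -> n%:R * s < 1 ->
  cylinder_band s x -> cylinder_band s y ->
  enorm (to_sphere x - to_sphere y) <=
    (1 + n%:R * s + n%:R * s / (1 - n%:R * s)) * enorm (x - y).
Proof.
move=> s0; set c := n%:R * s => c1 [x1 xs] [y1 ys].
have c0 : 0 <= c by rewrite mulr_ge0.
have tc z : tail_norm z <= s -> 0 <= enorm (tailp z) <= c.
  move=> zs; rewrite enorm_ge0; apply: le_trans (enorm_tail_le_tail_norm z) _.
  by rewrite ler_wpM2l.
pose r z := Num.sqrt (1 - enorm (tailp z) ^+ 2).
have rxy : `|r x - r y| <= c / (1 - c) * enorm (x - y).
  apply: le_trans (sqrt_one_minus_sqr_lipschitz c _ _ _ (tc _ xs) (tc _ ys)) _; first by rewrite c0.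
  rewrite ler_wpM2l //; first by rewrite divr_ge0 // subr_ge0 ltW.
  by rewrite (le_trans (ler_dist_enorm _ _)) // -tailpB enorm_tail_le.
have rx : `|r x - 1| <= c.
  have /andP[tx0 txc] := tc _ xs.
  have r1 : r x <= 1.
    by rewrite /r -[leRHS]sqrtr1 ler_wsqrtr // lerBlDr lerDl sqr_ge0.
  rewrite distrC ger0_norm ?subr_ge0 // lerBlDr addrC -lerBlDr.
  have c1' : 0 <= 1 - c by rewrite subr_ge0 ltW.
  rewrite /r -(ger0_norm c1') -sqrtr_sqr ler_wsqrtr //.
  move: tx0 txc; move: (enorm _) => t; nra.
have -> : to_sphere x - to_sphere y =
    (x - y) + ((r x - 1) *: (headp x - headp y) + (r x - r y) *: headp y).
  by rewrite /to_sphere -!/(r _); apply/rowP => i; rewrite !mxE; case: (i < k)%N; ring.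
apply: le_trans (ler_enormD _ _) _; rewrite !mulrDl mul1r -addrA lerD2l.
apply: le_trans (ler_enormD _ _) _; apply: lerD.
  by rewrite enormZ -headpB ler_pM ?enorm_ge0 // enorm_head_le.
by rewrite enormZ y1 mulr1.
Qed.

Lemma tail_norm_tail x : tail_norm (tailp x) = tail_norm x.
Proof. by apply: eq_bigr => i ki; rewrite mxE ltnNge ki. Qed.

Lemma tailp_eq_norm x y : tailp x = tailp y -> tail_norm x = tail_norm y.
Proof. by move=> xy; rewrite -tail_norm_tail xy tail_norm_tail. Qed.

Lemma tail_to_cylinder x : tailp (to_cylinder x) = tailp x.
Proof. by rewrite tailpD tailpZ tailp_headp scaler0 add0r tailp_tailp. Qed.

Lemma tail_to_sphere x : tailp (to_sphere x) = tailp x.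
Proof. by rewrite tailpD tailpZ tailp_headp scaler0 add0r tailp_tailp. Qed.

Lemma to_sphere_band s x : 0 <= s -> n%:R * s < 1 ->
  cylinder_band s x -> sphere_band s (to_sphere x).
Proof.
move=> s0 c1 [x1 xs]; split; last by rewrite (tailp_eq_norm _ _ (tail_to_sphere x)).
rewrite /unit_sphere /=; apply/eqP; rewrite -(eqrXn2 (ltn0Sn 1)) ?enorm_ge0 //.
rewrite enorm_head_tail tail_to_sphere headpD headpZ headp_headp headp_tailp addr0.
rewrite enormZ x1 mulr1 real_normK ?num_real // sqr_sqrtr ?subrK ?expr1n //.
rewrite subr_ge0 -(expr1n R 2) lerXn2r ?nnegrE ?enorm_ge0 //.
apply: le_trans (enorm_tail_le_tail_norm x) _; apply: le_trans (ltW c1).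
by rewrite ler_wpM2l.
Qed.

Lemma to_cylinder_band s u : 0 <= s -> n%:R * s < 1 ->
  sphere_band s u -> cylinder_band s (to_cylinder u).
Proof.
move=> s0 c1 [u1 us]; split; last by rewrite (tailp_eq_norm _ _ (tail_to_cylinder u)).
have hu : 0 < enorm (headp u).
  by apply: lt_le_trans (enorm_head_ge u s u1 us (ltW c1)); rewrite subr_gt0.
rewrite headpD headpZ headp_headp headp_tailp addr0 enormZ normfV ger0_norm ?enorm_ge0 //.
by rewrite mulVf // gt_eqF.
Qed.

Lemma to_sphereK s x : 0 <= s -> n%:R * s < 1 -> cylinder_band s x ->
  to_cylinder (to_sphere x) = x.
Proof.
move=> s0 c1 xP; have [u1 us] := to_sphere_band s x s0 c1 xP; have [x1 _] := xP.
have := enorm_head_ge _ s u1 us (ltW c1).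
rewrite /to_cylinder tail_to_sphere headpD headpZ headp_headp headp_tailp addr0.
rewrite enormZ x1 mulr1 ger0_norm ?sqrtr_ge0 // scalerA => H.
rewrite mulVf ?scale1r ?headDtail // gt_eqF // (lt_le_trans _ H) // subr_gt0 //.
Qed.

Lemma to_cylinderK s u : 0 <= s -> n%:R * s < 1 -> sphere_band s u ->
  to_sphere (to_cylinder u) = u.
Proof.
move=> s0 c1 [u1 us].
rewrite /to_sphere tail_to_cylinder headpD headpZ headp_headp headp_tailp addr0 scalerA.
have -> : 1 - enorm (tailp u) ^+ 2 = enorm (headp u) ^+ 2.
  by have := enorm_head_tail u; rewrite u1 expr1n => ->; rewrite addrK.
rewrite sqrtr_sqr ger0_norm ?enorm_ge0 // divff ?scale1r ?headDtail // gt_eqF //.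
by apply: lt_le_trans (enorm_head_ge u s u1 us (ltW c1)); rewrite subr_gt0.
Qed.

(** For c = n s <= 1/2 both Lipschitz constants, 1/(1 - c) and 1 + c + c/(1 - c), are at most 1 +
    3c; the second one dictates the 3. *)
Lemma hausdorff_outer_cylinder_band_le m s : 0 <= s -> n%:R * s <= 2^-1 ->
  (hausdorff_outer m (cylinder_band s) <=
    ((1 + 3 * n%:R * s) ^+ m)%:E * hausdorff_outer m (sphere_band s))%E.
Proof.
move=> s0 ns; have ns0 : 0 <= n%:R * s by rewrite mulr_ge0.
have c1 : n%:R * s < 1 by lra.
have sub : cylinder_band s `<=` to_cylinder @` sphere_band s.
  by move=> x xs; exists (to_sphere x); [exact: to_sphere_band|exact: (to_sphereK s)].
apply: le_trans (le_hausdorff_outer m sub) _; apply: hausdorff_outer_lipschitz.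
  by rewrite -mulrA; lra.
move=> x y xs ys; apply: le_trans (to_cylinder_lipschitz s x y s0 c1 xs ys) _.
rewrite ler_wpM2r ?enorm_ge0 // -mulrA invf_ple ?posrE ?subr_gt0 //; last by lra.
rewrite -[leLHS]div1r ler_pdivrMr; nra.
Qed.

Lemma hausdorff_outer_sphere_band_le m s : 0 <= s -> n%:R * s <= 2^-1 ->
  (hausdorff_outer m (sphere_band s) <=
    ((1 + 3 * n%:R * s) ^+ m)%:E * hausdorff_outer m (cylinder_band s))%E.
Proof.
move=> s0 ns; have ns0 : 0 <= n%:R * s by rewrite mulr_ge0.
have c1 : n%:R * s < 1 by lra.
have sub : sphere_band s `<=` to_sphere @` cylinder_band s.
  by move=> x xs; exists (to_cylinder x); [exact: to_cylinder_band|exact: (to_cylinderK s)].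
apply: le_trans (le_hausdorff_outer m sub) _; apply: hausdorff_outer_lipschitz.
  by rewrite -mulrA; lra.
move=> x y xs ys; apply: le_trans (to_sphere_lipschitz s x y s0 c1 xs ys) _.
rewrite ler_wpM2r ?enorm_ge0 // -[3 * _ * _]mulrA -addrA lerD2l.
have -> : 3 * (n%:R * s) = n%:R * s + 2 * (n%:R * s) by ring.
rewrite lerD2l ler_pdivrMr ?subr_gt0 //; nra.
Qed.

End HeadTail.

(** Such a function is monotone. Comparing N s with its integer part gives N |phi s - s phi 1| <=
    phi 1 for every N, which forces equality. *)
Lemma additive_nonneg_linear {R : realType} (phi : R -> R) :
  (forall a, 0 <= a -> 0 <= phi a) ->
  (forall a b, 0 <= a -> 0 <= b -> phi (a + b) = phi a + phi b) ->
  forall s, 0 <= s -> phi s = s * phi 1.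
Proof.
move=> phi0 phiD s s0.
have phi_le a b : 0 <= a -> a <= b -> phi a <= phi b.
  move=> a0 ab; rewrite -(subrKC a b) phiD ?subr_ge0 // lerDl phi0 // subr_ge0 //.
have phi00 : phi 0 = 0.
  by have := phiD 0 0 (lexx _) (lexx _); rewrite addr0 => /eqP; rewrite -subr_eq0 opprD addrA subrr sub0r oppr_eq0 => /eqP.
have phiM N a : 0 <= a -> phi (N%:R * a) = N%:R * phi a.
  move=> a0; elim: N => [|N IH]; first by rewrite !mul0r.
  by rewrite -natr1 !mulrDl !mul1r phiD ?IH // mulr_ge0.
have phi1 N : phi N%:R = N%:R * phi 1 by rewrite -[in LHS](mulr1 N%:R) phiM.
have p1 : 0 <= phi 1 by exact: phi0.
have key N : N%:R * `|phi s - s * phi 1| <= phi 1.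
  have Ns : 0 <= N%:R * s by rewrite mulr_ge0.
  have /truncn_itv/andP[l1 l2] := Ns.
  have h1 := phi_le _ _ (ler0n _ _) l1; have h2 := phi_le _ _ Ns (ltW l2).
  move: h1 h2; rewrite !phi1 phiM // => h1 h2.
  rewrite -[N%:R in leLHS]ger0_norm // -normrM mulrBr mulrA ler_norml.
  rewrite -natr1 in l2 h2; move: l1 l2 h1 h2; move: (N%:R * s) (_%:R) (N%:R * phi s) (phi 1) p1 => a b c p p1 l1 l2 h1 h2.
  by apply/andP; split; nra.
apply/eqP; rewrite -subr_eq0 -normr_le0 leNgt; apply/negP => pos.
have q0 : 0 <= phi 1 / `|phi s - s * phi 1| by rewrite divr_ge0.
have /truncn_itv/andP[_] := q0; rewrite ltr_pdivrMr // => h.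
by have := key (Num.trunc (phi 1 / `|phi s - s * phi 1|)).+1; rewrite leNgt h.
Qed.

(** * Exact measure of boxes over the unit sphere of R^k, and bounds for the bands *)

Section Boxes.
Context {R : realType} {d : nat} (k : nat).
Hypothesis k_gt0 : (0 < k)%N.
Hypothesis k_le : (k <= d)%N.
Local Notation n := d.+1.
Local Notation V := 'rV[R]_n.
Local Notation mu := (@hausdorff_outer R n d).

(** Half-open sides starting at 0: a cut across one side gives exactly a box and a translate of a
    box. *)
Definition box (t : 'I_n -> R) : set V :=
  [set x | enorm (headp k x) = 1 /\
           forall i : 'I_n, (k <= i)%N -> 0 <= x ord0 i < t i].

Lemma eq_box t t' : (forall i : 'I_n, (k <= i)%N -> t i = t' i) -> box t = box t'.
Proof.
move=> tt'; apply/seteqP; split=> x [x1 xt]; split=> // i ki.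
  by rewrite -tt' // xt.
by rewrite tt' // xt.
Qed.

Definition upd (t : 'I_n -> R) j (a : R) i := if i == j then a else t i.

Lemma coord_lipschitz (j : 'I_n) (x y : V) : `|x ord0 j - y ord0 j| <= enorm (x - y).
Proof. by have := coord_le_enorm (x - y) j; rewrite !mxE. Qed.

Lemma box_additive t (j : 'I_n) a b : (k <= j)%N -> 0 <= a -> 0 <= b ->
  (mu (box (upd t j (a + b))) = mu (box (upd t j a)) + mu (box (upd t j b)))%E.
Proof.
move=> kj a0 b0.
have lip (x y : V) : `|- x ord0 j - - y ord0 j| <= enorm (x - y).
  by rewrite opprK addrC distrC -normrN opprB (distrC (y ord0 j)) coord_lipschitz.
(* The cut is made by {x_j < a}, the complement of the sublevel set {-x_j <= -a}, to match the
   half-open sides. *)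
have M := caratheodory_measurable_setC
  (lipschitz_sublevel_caratheodory (m := d) _ lip (- a)).
have := M (box (upd t j (a + b))); rewrite setCK /= => ->; congr (_ + _)%E.
  congr mu; apply/seteqP; split=> x /=.
    move=> [[x1 xt] /negP]; rewrite -ltNge ltrN2 => xa; split=> // i ki.
    by have := xt i ki; rewrite /upd; case: eqP => [->|//] /andP[-> _].
  move=> [x1 xt]; split; last first.
    by apply/negP; rewrite -ltNge ltrN2; have := xt j kj; rewrite /upd eqxx => /andP[].
  split=> // i ki; have := xt i ki; rewrite /upd; case: eqP => // _ /andP[-> h].
  by rewrite (lt_le_trans h) // lerDl.
pose v : V := a *: delta_mx 0 j.
have vE i : v ord0 i = if i == j then a else 0.
  by rewrite !mxE eqxx /=; case: eqP => _; rewrite ?mulr1 ?mulr0.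
have hv : headp k v = 0.
  by apply/rowP => i; rewrite mxE vE mxE; case: ltnP => // ik; case: eqP => // ij; move: ik; rewrite ij ltnNge kj.
rewrite -(hausdorff_outer_translate d (box (upd t j b)) v); congr mu.
apply/seteqP; split=> x /=.
  move=> [[x1 xt]]; rewrite lerN2 => ax; exists (x - v); last by rewrite subrK.
  split; first by rewrite headpB hv subr0.
  move=> i ki; have := xt i ki; rewrite /upd [(x - v) _ _]mxE [(- v) _ _]mxE vE.
  case: eqP => [->|_]; last by rewrite subr0.
  by move=> /andP[_ h]; rewrite subr_ge0 ax /= ltrBlDl.
move=> [y [y1 yt] <-]; split; last first.
  by have := yt j kj; rewrite /upd eqxx lerN2 mxE vE eqxx lerDr => /andP[].
split; first by rewrite headpD hv addr0.
move=> i ki; have := yt i ki; rewrite /upd mxE vE; case: eqP => _; last by rewrite addr0.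
by move=> /andP[h1 h2]; rewrite addr_ge0 //= addrC ltrD2l.
Qed.

Lemma sphere_band_lty s : (mu (sphere_band k s) < +oo)%E.
Proof.
apply: le_lt_trans (hausdorff_outer_sphere_lty d).
by apply: le_hausdorff_outer => u [].
Qed.

(** The comparison with the sphere works for thin bands only; a thick band is a thin one with its
    tail stretched. *)
Lemma cylinder_band_lty s : 0 <= s -> (mu (cylinder_band k s) < +oo)%E.
Proof.
move=> s0; pose c : R := 1 + 2 * n%:R * s.
have c1 : 1 <= c by rewrite lerDl !mulr_ge0.
have c0 : 0 < c by apply: lt_le_trans c1.
have r0 : 0 <= s / c by rewrite divr_ge0 // ltW.
have rn : n%:R * (s / c) <= 2^-1.
  rewrite mulrA ler_pdivrMr // ler_pdivlMl // /c mulrA; lra.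
have fin : (mu (cylinder_band k (s / c)) < +oo)%E.
  apply: le_lt_trans (hausdorff_outer_cylinder_band_le k d _ r0 rn) _.
  by rewrite lte_mul_pinfty ?sphere_band_lty // lee_fin exprn_ge0 // addr_ge0 // mulr_ge0 // mulr_ge0.
pose f (x : V) := headp k x + c *: tailp k x.
have sub : cylinder_band k s `<=` f @` cylinder_band k (s / c).
  move=> x [x1 xs]; exists (headp k x + c^-1 *: tailp k x); last first.
    rewrite /f headpD tailpD headpZ tailpZ headp_headp headp_tailp tailp_headp tailp_tailp.
    by rewrite scaler0 addr0 add0r scalerA divff ?gt_eqF // scale1r headDtail.
  split; first by rewrite headpD headpZ headp_headp headp_tailp scaler0 addr0.
  rewrite -tail_norm_tail tailpD tailpZ tailp_headp tailp_tailp add0r.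
  by rewrite tail_normZ ?invr_ge0 ?(ltW c0) // tail_norm_tail mulrC ler_pM2r ?invr_gt0.
apply: le_lt_trans (le_hausdorff_outer d sub) _.
have lip : (mu (f @` cylinder_band k (s / c)) <=
    (c ^+ d)%:E * mu (cylinder_band k (s / c)))%E.
  apply: hausdorff_outer_lipschitz => // x y _ _.
  rewrite -[c in leRHS]ger0_norm ?(ltW c0) // -enormZ; apply: le_enorm => i.
  rewrite !mxE !normrM (ger0_norm (ltW c0)); case: ifP => _.
    by rewrite !mulr0 !addr0 ler_peMl.
  by rewrite !add0r -mulrBr normrM (ger0_norm (ltW c0)).
by apply: le_lt_trans lip _; rewrite lte_mul_pinfty // lee_fin exprn_ge0 // ltW.
Qed.

Lemma box_lty t : (mu (box t) < +oo)%E.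
Proof.
pose s := \big[Num.max/0]_i `|t i|.
have s0 : 0 <= s by exact: bigmax_ge_id.
apply: le_lt_trans (cylinder_band_lty s s0); apply: le_hausdorff_outer => x [x1 xt].
split=> //; apply/tail_norm_leP => // i ki; have /andP[xi0 xi] := xt i ki.
rewrite ger0_norm // (le_trans (ltW xi)) // (le_trans (ler_norm _)) //.
exact: (le_bigmax _ (fun i => `|t i|)).
Qed.

Lemma box_fin t : mu (box t) \is a fin_num.
Proof. by rewrite ge0_fin_numE ?hausdorff_outer_ge0 // box_lty. Qed.

Definition boxG : R := fine (mu (box (fun=> 1))).

(* The measure is additive in each side length, hence proportional to it. *)
Lemma box_scale_seq s (J : seq 'I_n) : 0 <= s -> uniq J ->
  {in J, forall j : 'I_n, (k <= j)%N} ->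
  fine (mu (box (fun i => if i \in J then s else 1))) = s ^+ size J * boxG.
Proof.
move=> s0; elim: J => [_ _|j J IH /= /andP[jJ uJ] kJ].
  by rewrite expr0 mul1r; congr (fine (mu _)); exact: eq_box.
have kj : (k <= j)%N by apply: kJ; rewrite mem_head.
pose t i := if i \in J then s else 1.
pose phi a := fine (mu (box (upd t j a))).
have phiE : phi s = s * phi 1.
  apply: (additive_nonneg_linear phi) => // [a _|a b a0 b0].
    by rewrite fine_ge0 // hausdorff_outer_ge0.
  by rewrite /phi box_additive // fineD ?box_fin.
rewrite (_ : box _ = box (upd t j s)); last first.
  by apply: eq_box => i _; rewrite /upd /t in_cons; case: eqP.
rewrite -/(phi s) phiE exprS -mulrA -IH //; last first.
  by move=> i iJ; apply: kJ; rewrite in_cons iJ orbT.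
congr (_ * fine (mu _)); apply: eq_box => i _.
by rewrite /upd /t; case: eqP => // ->; rewrite (negbTE jJ).
Qed.

Lemma box_scale s : 0 <= s -> fine (mu (box (fun=> s))) = s ^+ (n - k) * boxG.
Proof.
move=> s0; pose J := [seq i : 'I_n <- enum 'I_n | (k <= i)%N].
have sJ : size J = (n - k)%N.
  rewrite size_filter -(count_map val (leq k)) val_enum_ord.
  rewrite -{1}(subnKC (leqW k_le)) iotaD count_cat add0n.
  rewrite (_ : count _ (iota 0 k) = 0%N); last first.
    apply/eqP; rewrite -leqn0 leqNgt -has_count; apply/hasPn => i.
    by rewrite mem_iota /= add0n -ltnNge.
  rewrite add0n -[RHS](size_iota k); apply/eqP.
  by rewrite -all_count; apply/allP => i; rewrite mem_iota => /andP[].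
rewrite -sJ -box_scale_seq //; first last.
- by move=> j; rewrite mem_filter => /andP[].
- by rewrite filter_uniq // enum_uniq.
by congr (fine (mu _)); apply: eq_box => i ki; rewrite mem_filter ki mem_enum.
Qed.

Lemma enorm_drop_le (x : V) : enorm (\row_(j < d) x ord0 (lift ord0 j)) <= enorm x.
Proof.
rewrite enorm_le ?enorm_ge0 // enorm_sqr [leRHS]/dotp (bigD1_ord ord0) //= ler_wpDl //.
  by rewrite -expr2 sqr_ge0.
by apply: ler_sum => j _; rewrite !mxE.
Qed.

(** Dropping coordinate 0, which belongs to the head, and scaling by n is a Lipschitz map of the box
    onto a set containing the d-dimensional unit cube. *)
Lemma boxG_gt0 : 0 < boxG.
Proof.
rewrite fine_gt0 // box_lty andbT.
have n0 : 0 < n%:R :> R by rewrite ltr0n.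
have d0 : (0 < d)%N by apply: leq_trans k_le.
pose f (x : V) : 'rV[R]_d := n%:R *: \row_j x ord0 (lift ord0 j).
have sub : @unit_cube R d `<=` f @` box (fun=> 1).
  move=> y yc.
  pose z : V := \row_i if unlift ord0 i is Some j then y ord0 j / n%:R else 0.
  have z1 : enorm (headp k z) <= 1.
    rewrite (le_trans (enorm_head_le k z)) // -[leRHS](mulfV (lt0r_neq0 n0)).
    apply: enorm_le_coord => [|i]; first by rewrite invr_ge0.
    rewrite mxE; case: unliftP => [j _|_]; last by rewrite normr0 invr_ge0.
    have /andP[y0 y1] := yc j.
    by rewrite ger0_norm ?divr_ge0 // ler_piMl // invr_ge0.
  (* The dropped coordinate is recovered so that the head becomes a unit vector; shrinking y by n
     ensured that the head of z has length at most 1. *)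
  pose c := Num.sqrt (1 - enorm (headp k z) ^+ 2).
  pose x : V := z + c *: delta_mx 0 ord0.
  have xl j : x ord0 (lift ord0 j) = y ord0 j / n%:R.
    by rewrite !mxE liftK /= mulr0 addr0.
  have hdelta : headp k (delta_mx 0 ord0 : V) = delta_mx 0 ord0.
    apply/rowP => i; rewrite !mxE; case: ltnP => // ki.
    by rewrite eqxx /=; case: eqP => // i0; move: ki; rewrite i0 leqNgt k_gt0.
  exists x; last by apply/rowP => j; rewrite !mxE liftK /= mulr0 addr0 mulrC divfK // gt_eqF.
  split.
    rewrite /enorm headpD headpZ hdelta dotpDl !dotpDr !dotpZl !dotpZr (dotpC _ (headp k z)).
    rewrite !dotp_delta [headp k z _ _]mxE k_gt0 mxE unlift_none mxE !eqxx.
    rewrite mulr0 addr0 add0r mulr1 -expr2 sqr_sqrtr; last first.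
      by rewrite subr_ge0 expr_le1 // enorm_ge0.
    by rewrite enorm_sqr subrKC sqrtr1.
  move=> i ki; have [j ij|i0] := unliftP ord0 i; last by move: ki; rewrite i0 leqNgt k_gt0.
  rewrite ij xl; have /andP[y0 y1] := yc j; rewrite divr_ge0 //= ltr_pdivrMr // mul1r.
  by apply: le_lt_trans y1 _; rewrite ltr1n ltnS.
have lip : (hausdorff_outer d (f @` box (fun=> 1%R)) <=
    (n%:R ^+ d)%:E * mu (box (fun=> 1%R)))%E.
  apply: hausdorff_outer_lipschitz => // x y _ _.
  rewrite /f -scalerBr enormZ ger0_norm // ler_wpM2l //.
  by apply: le_trans (enorm_drop_le _); rewrite le_eqVlt; apply/orP; left; apply/eqP; congr enorm; apply/rowP => j; rewrite !mxE.
have := lt_le_trans (lt_le_trans (hausdorff_outer_unit_cube_gt0 d d0)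
  (le_hausdorff_outer d sub)) lip.
rewrite !lt0e hausdorff_outer_ge0 andbT => /andP[+ _].
by apply: contra => /eqP ->; rewrite mule0.
Qed.

(** The closed cube [-s, s]^m lies between translates of half-open cubes of sides 2s and 2sa; a > 1
    is the price of the missing endpoints. *)
Lemma cylinder_band_bounds s a : 0 < s -> 1 < a ->
  (2 * s) ^+ (n - k) * boxG <= fine (mu (cylinder_band k s)) <= (2 * s * a) ^+ (n - k) * boxG.
Proof.
move=> s0 a1; have a0 : 0 < a by apply: lt_trans a1.
have fin : mu (cylinder_band k s) \is a fin_num.
  by rewrite ge0_fin_numE ?hausdorff_outer_ge0 // cylinder_band_lty // ltW.
pose v r : V := \row_i if (i < k)%N then 0 else r.
have hv r : headp k (- v r) = 0.
  by apply/rowP => i; rewrite !mxE; case: (i < k)%N; rewrite ?oppr0.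
have s20 : 0 <= 2 * s by rewrite mulr_ge0 // ltW.
have sa0 : 0 <= 2 * s * a by rewrite mulr_ge0 // ltW.
rewrite -!box_scale //; apply/andP; split; apply: fine_le; rewrite ?box_fin //.
  rewrite -(hausdorff_outer_translate d _ (- v s)); apply: le_hausdorff_outer => _ [x [x1 xs] <-].
  split; first by rewrite headpD hv addr0.
  apply/tail_norm_leP => [|i ki]; first exact: ltW.
  have := xs i ki; rewrite !mxE ltnNge ki /= ler_norml => /andP[? ?].
  by apply/andP; split; lra.
rewrite -(hausdorff_outer_translate d (box _) (- v (s * a))); apply: le_hausdorff_outer => x [x1 xs].
exists (x + v (s * a)); last by rewrite addrK.
split; first by rewrite -[v _]opprK headpB hv subr0.
move=> i ki; have := (tail_norm_leP k x s (ltW s0)).2 xs i ki.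
rewrite !mxE ltnNge ki /= ler_norml => /andP[? ?].
have : s < s * a by rewrite ltr_pMr.
by move=> ?; apply/andP; split; lra.
Qed.

Lemma sphere_band_bounds s : 0 < s -> n%:R * s <= 2^-1 ->
  (2 * s) ^+ (n - k) * boxG / (1 + 3 * n%:R * s) ^+ d <= fine (mu (sphere_band k s)) <=
  (1 + 3 * n%:R * s) ^+ d * ((2 * s * (1 + s)) ^+ (n - k) * boxG).
Proof.
move=> s0 ns.
have K0 : 0 < 1 + 3 * n%:R * s by rewrite ltr_pwDl // !mulr_ge0 // ltW.
have s1 : 1 < 1 + s by rewrite ltrDl.
(* The enlargement factor 1 + s tends to 1 together with s. *)
have /andP[h1 h2] := cylinder_band_bounds s (1 + s) s0 s1.
have fc : mu (cylinder_band k s) \is a fin_num.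
  by rewrite ge0_fin_numE ?hausdorff_outer_ge0 // cylinder_band_lty // ltW.
have fs : mu (sphere_band k s) \is a fin_num.
  by rewrite ge0_fin_numE ?hausdorff_outer_ge0 // sphere_band_lty.
have := hausdorff_outer_cylinder_band_le k d s (ltW s0) ns.
have := hausdorff_outer_sphere_band_le k d s (ltW s0) ns.
rewrite -[mu (sphere_band k s)]fineK // -[mu (cylinder_band k s)]fineK // -!EFinM !lee_fin => g1 g2.
apply/andP; split.
  by rewrite ler_pdivrMr ?exprn_gt0 // (le_trans h1) // mulrC.
by apply: le_trans g1 _; rewrite ler_wpM2l // exprn_ge0 // ltW.
Qed.

End Boxes.

(** * Asymptotics of the integrals *)

Section RecursiveAsymptotics.
Context {R : realType}.

(** The recursion reproduces bounds of the form M' e^q exactly, so such a bound propagates from the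
    window [d0, lam d0] to all smaller scales; q > m makes it negligible against e^m. *)
Lemma eventually_decay (Y : R -> R) (lam q d0 M : R) (m : nat) : 1 < lam -> 0 < d0 ->
  0 <= M -> m%:R < q ->
  (forall e, 0 < e < d0 -> Y e <= (lam `^ q)^-1 * Y (lam * e)) ->
  (forall e, d0 <= e <= lam * d0 -> Y e <= M) ->
  forall t, 0 < t -> \forall e \near 0^'+, Y e <= t * e ^+ m.
Proof.
move=> lam1 d00 M0 mq Yrec YM t t0.
have lam0 : 0 < lam by apply: lt_trans lam1.
have q0 : 0 <= q by apply: le_trans (ltW mq).
(* Chosen so that M <= M' e^q on the starting window. *)
pose M' := M / d0 `^ q.
have M'0 : 0 <= M' by rewrite divr_ge0 // powR_ge0.
have claim i e : d0 / lam ^+ i <= e -> e <= lam * d0 -> Y e <= M' * e `^ q.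
  elim: i e => [|i IH] e.
    rewrite expr0 divr1 => de el; apply: le_trans (YM e _) _; first by rewrite de.
    rewrite /M' -mulrA ler_peMr // -[leLHS](mulVf (lt0r_neq0 (powR_gt0 q d00))).
    rewrite ler_pM2l ?invr_gt0 ?powR_gt0 //.
    by apply: ge0_ler_powR; rewrite ?nnegrE // ?(le_trans _ de) // ltW.
  move=> de el; have [d0e|ed0] := leP d0 e.
    by apply: IH el; apply: le_trans d0e; rewrite ler_pdivrMr ?exprn_gt0 // ler_peMr ?exprn_ege1 // ltW.
  have e0 : 0 < e by apply: lt_le_trans de; rewrite divr_gt0 ?exprn_gt0.
  apply: le_trans (Yrec e _) _; first by rewrite e0.
  have Yle : Y (lam * e) <= M' * (lam * e) `^ q.
    apply: IH; last by rewrite ler_pM2l // ltW.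
    by rewrite -ler_pdivrMl // mulrC; move: de; rewrite exprSr invfM mulrA.
  apply: le_trans (ler_wpM2l _ Yle) _; first by rewrite invr_ge0 powR_ge0.
  rewrite powRM ?(ltW lam0) ?(ltW e0) // mulrCA !mulrA divfK //.
  by rewrite gt_eqF // powR_gt0.
have all e : 0 < e -> e <= d0 -> Y e <= M' * e `^ q.
  move=> e0 ed; pose x := lam - 1.
  have x0 : 0 < x by rewrite subr_gt0.
  (* Bernoulli's inequality: finitely many steps lead from the window down to any given e. *)
  have big i : 1 + i%:R * x <= lam ^+ i.
    elim: i => [|i IH]; first by rewrite mul0r addr0 expr0.
    rewrite exprS -natr1; apply: le_trans (ler_wpM2l (ltW lam0) IH).
    have ix : 0 <= i%:R * x * x by rewrite !mulr_ge0 // ltW.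
    have -> : lam = 1 + x by rewrite /x addrC subrK.
    rewrite (_ : (1 + x) * (1 + i%:R * x) = 1 + (i%:R + 1) * x + i%:R * x * x); last by ring.
    by rewrite lerDl.
  pose i := (Num.trunc (d0 / e / x)).+1.
  apply: (claim i); last by rewrite (le_trans ed) // ler_peMl // ltW.
  rewrite ler_pdivrMr ?exprn_gt0 // -ler_pdivrMl // mulrC (le_trans _ (big i)) //.
  have /truncn_itv/andP[_] : 0 <= d0 / e / x by rewrite !divr_ge0 // ltW.
  rewrite ltr_pdivrMr // -/i => /ltW h.
  by rewrite (le_trans h) // lerDr.
have cv : M' * e `^ (q - m%:R) @[e --> 0^'+] --> M' * 0.
  by apply: cvgM; [exact: cvg_cst|apply: powR_cvg0; rewrite subr_gt0].
near=> e.
have e0 : 0 < e by near: e; exact: nbhs_right_gt.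
have ed : e <= d0 by apply: ltW; near: e; exact: nbhs_right_lt.
apply: le_trans (all e e0 ed) _.
have -> : e `^ q = e `^ (q - m%:R) * e ^+ m.
  rewrite -powR_mulrn ?(ltW e0) // -powRD ?subrK //.
  by apply/implyP => _; rewrite gt_eqF.
rewrite mulrA ler_wpM2r ?exprn_ge0 ?(ltW e0) //.
near: e; apply: cvgr_le cv _ _; by rewrite mulr0.
Unshelve. all: by end_near. Qed.

Lemma oneBexpRN_le (y : R) : 1 - expR (- y) <= y.
Proof. by have := expR_ge1Dx (- y); lra. Qed.

(** Together with the preceding upper bound this shows that 1 - lam^(-q) and 1 - lam^(-p), for lam =
    exp t with t small, are nearly in the ratio q : p. *)
Lemma le_oneBexpRN (y : R) : y * expR (- y) <= 1 - expR (- y).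
Proof.
have := expR_ge1Dx y; rewrite -(ler_pM2r (expR_gt0 (- y))) mulrDl mul1r.
by rewrite -expRD subrr expR0; lra.
Qed.

(* To be applied to [F e = mu {h <= e}] and [E e = \int (max 1 (h/e))^-q]. The
   recursive bounds give [E e <= B e^m + M' e^q] and a similar lower bound by
   induction on the scale [e], with [B] as close as we please to
   [c q / (q - m)] when [lam] is close to 1. *)
Lemma recursive_asymptotic (F E : R -> R) (q c M : R) (m : nat) : m%:R < q -> 0 < c ->
  F s / s ^+ m @[s --> 0^'+] --> c ->
  (forall e, 0 < e -> 0 <= E e <= M) ->
  (forall lam e, 1 < lam -> 0 < e ->
     (lam `^ q)^-1 * E (lam * e) + (1 - (lam `^ q)^-1) * F e <= E e <=
     (lam `^ q)^-1 * E (lam * e) + (1 - (lam `^ q)^-1) * F (lam * e)) ->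
  E e / e ^+ m @[e --> 0^'+] --> c * (q / (q - m%:R)).
Proof.
move=> mq c0 cvF EM Erec.
have q0 : 0 < q by apply: le_lt_trans mq.
set p := q - m%:R; have p0 : 0 < p by rewrite subr_gt0.
have M0 : 0 <= M by have /andP[/le_trans] := EM 1 ltr01; apply.
(* The one parameter t is at once the tolerance on F, the logarithm of lam, and the error left by
   the decay lemma. *)
have bounds t : 0 < t < c -> \forall e \near 0^'+,
    (c - t) * (q / p) * expR (- (q * t)) - t <= E e / e ^+ m <=
    (c + t) * (q / p) * expR (q * t) + t.
  move=> /andP[t0 tc]; pose lam := expR t; have lam1 : 1 < lam by rewrite expR_gt1.
  have lam0 : 0 < lam by exact: expR_gt0.
  have lamq : lam `^ q = expR (q * t) by rewrite mulrC expRM.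
  have lamm : lam ^+ m = expR (m%:R * t) by rewrite expRM_natl.
  have L0 : 0 < expR (- (q * t)) by exact: expR_gt0.
  have L1 : expR (- (q * t)) <= 1 by rewrite expR_le1 oppr_le0 mulr_ge0 // ltW.
  have Lm : expR (- (q * t)) * lam ^+ m = expR (- (p * t)).
    by rewrite lamm -expRD; congr expR; rewrite /p; ring.
  have Lm' : expR (q * t) = lam ^+ m * expR (p * t).
    by rewrite lamm -expRD; congr expR; rewrite /p; ring.
  have [d /= d0 Fd] : \forall s \near 0^'+, c - t <= F s / s ^+ m <= c + t.
    near=> s; apply/andP; split; near: s.
      by apply: cvgr_ge cvF _ _; rewrite ltrBlDr ltrDl.
    by apply: cvgr_le cvF _ _; rewrite ltrDl.
  have {}Fd s : 0 < s < d -> (c - t) * s ^+ m <= F s <= (c + t) * s ^+ m.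
    move=> /andP[s0 sd]; have := Fd s; rewrite /ball_ /= sub0r normrN gtr0_norm // => /(_ sd s0).
    by rewrite ler_pdivlMr ?exprn_gt0 // ler_pdivrMr ?exprn_gt0.
  (* Below d1 the bounds on F hold at both e and lam e. *)
  pose d1 := d / lam; have d10 : 0 < d1 by rewrite divr_gt0.
  have d1d : d1 < d by rewrite ltr_pdivrMr // ltr_pMr.
  have small e : 0 < e < d1 -> 0 < lam * e < d.
    by move=> /andP[e0 ed]; rewrite mulr_gt0 //= mulrC -ltr_pdivlMr.
  have qp0 : 0 < q / p by rewrite divr_gt0.
  (* The subtracted multiple of e^m is a supersolution of the recursion, so the difference satisfies
     the homogeneous recursion of the decay lemma. *)
  have up : \forall e \near 0^'+, E e - (c + t) * (q / p) * expR (q * t) * e ^+ m <= t * e ^+ m.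
    apply: (eventually_decay _ lam q d1 M m lam1 d10 M0 mq _ _ _ t0) => e /=; last first.
      move=> /andP[de _]; have e0 := lt_le_trans d10 de.
      have /andP[_ EM'] := EM e e0; apply: le_trans EM'.
      rewrite lerBlDr lerDl mulr_ge0 ?exprn_ge0 ?(ltW e0) //.
      by rewrite mulr_ge0 ?expR_ge0 // mulr_ge0 ?(ltW qp0) // addr_ge0 // ltW.
    move=> ed; have /andP[e0 _] := ed.
    have /andP[_] := Erec lam e lam1 e0; rewrite lamq -expRN => h.
    have /andP[_ hF] := Fd _ (small _ ed).
    rewrite lerBlDr; apply: le_trans h _.
    apply: (@le_trans _ _ (expR (- (q * t)) * E (lam * e) +
        (1 - expR (- (q * t))) * ((c + t) * (lam * e) ^+ m))).
      by rewrite lerD2l ler_wpM2l // subr_ge0.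
    rewrite exprMn -subr_ge0.
    set B := (c + t) * (q / p) * expR (q * t).
    rewrite [leRHS](_ : _ = (c + t) * lam ^+ m * e ^+ m *
      ((q / p) * (expR (p * t) - expR (p * t) * (expR (- (q * t)) * lam ^+ m)) - (1 - expR (- (q * t))))); last first.
      by rewrite /B Lm'; ring.
    rewrite Lm -expRD subrr expR0.
    apply: mulr_ge0; first by rewrite !mulr_ge0 ?exprn_ge0 ?addr_ge0 // ltW.
    (* What remains is 1 - exp(-qt) <= (q/p) (exp(pt) - 1): both sides are compared with qt. *)
    rewrite subr_ge0; apply: le_trans (oneBexpRN_le (q * t)) _.
    apply: (@le_trans _ _ ((q / p) * (p * t))); last first.
      by rewrite ler_pM2l //; have := expR_ge1Dx (p * t); lra.
    by rewrite mulrA divfK // gt_eqF.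
  have ct0 : 0 <= (c - t) * (q / p) by rewrite mulr_ge0 ?(ltW qp0) // subr_ge0 ltW.
  (* Here the multiple of e^m is a subsolution; on the starting window E >= 0 is simply dropped. *)
  have lo : \forall e \near 0^'+, (c - t) * (q / p) * expR (- (q * t)) * e ^+ m - E e <= t * e ^+ m.
    apply: (eventually_decay _ lam q d1 ((c - t) * (q / p) * expR (- (q * t)) * (lam * d1) ^+ m)
        m lam1 d10 _ mq _ _ _ t0) => [|e|e] /=.
    - by rewrite mulr_ge0 ?(mulr_ge0 ct0) ?expR_ge0 // exprn_ge0 // mulr_ge0 // ltW.
    - move=> /andP[e0 ed]; have ed' : 0 < e < d by rewrite e0 (lt_trans ed).
      have /andP[h _] := Erec lam e lam1 e0; move: h; rewrite lamq -expRN => h.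
      have /andP[hF _] := Fd _ ed'.
      rewrite lerBlDr; apply: le_trans (lerD (lexx _) h).
      apply: (@le_trans _ _ (expR (- (q * t)) * ((c - t) * (q / p) * expR (- (q * t)) * (lam ^+ m * e ^+ m)) +
        (1 - expR (- (q * t))) * ((c - t) * e ^+ m))); last first.
        by rewrite mulrBr exprMn addrA subrK lerD2l ler_wpM2l // subr_ge0.
      rewrite -subr_ge0 [leRHS](_ : _ = (c - t) * e ^+ m *
        ((1 - expR (- (q * t))) - (q / p) * expR (- (q * t)) * (1 - expR (- (q * t)) * lam ^+ m))); last by ring.
      rewrite Lm mulr_ge0 ?mulr_ge0 ?exprn_ge0 ?subr_ge0 ?(ltW tc) ?(ltW e0) //.
      apply: le_trans (le_oneBexpRN (q * t)).
      rewrite mulrAC ler_wpM2r ?expR_ge0 //.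
      apply: le_trans (ler_wpM2l (ltW qp0) (oneBexpRN_le (p * t))) _.
      by rewrite mulrA divfK // gt_eqF.
    - move=> /andP[de el]; have e0 := lt_le_trans d10 de.
      have /andP[E0 _] := EM e e0; rewrite lerBlDr ler_wpDr //.
      apply: ler_wpM2l; first by rewrite (mulr_ge0 ct0) ?expR_ge0.
      by apply: lerXn2r => //; rewrite nnegrE ltW // mulr_gt0.
  near=> e.
  have e0 : 0 < e by near: e; exact: nbhs_right_gt.
  have em0 : 0 < e ^+ m by rewrite exprn_gt0.
  apply/andP; split.
    rewrite ler_pdivlMr // mulrBl lerBlDr -lerBlDl.
    by near: e; exact: lo.
  rewrite ler_pdivrMr // mulrDl -lerBlDl.
  by near: e; exact: up.
have cvexp (a b : R) : (c + b * t) * (q / p) * expR (a * t) + b * t @[t --> 0^'+] --> c * (q / p).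
  rewrite [X in _ --> X](_ : _ = (c + b * 0) * (q / p) * expR (a * 0) + b * 0); last first.
    by rewrite !mulr0 expR0 !addr0 mulr1.
  apply: cvg_at_right_filter; apply: cvgD; last by apply: cvgM; [exact: cvg_cst|exact: cvg_id].
  apply: cvgM.
    by apply: cvgM; [apply: cvgD; [exact: cvg_cst|apply: cvgM; [exact: cvg_cst|exact: cvg_id]]|exact: cvg_cst].
  apply: continuous_cvg; first exact: continuous_expR.
  by apply: cvgM; [exact: cvg_cst|exact: cvg_id].
apply/cvgrPdist_le => eta eta0.
have [t [t0c ut lt]] : exists t, [/\ 0 < t < c,
    (c + t) * (q / p) * expR (q * t) + t <= c * (q / p) + eta &
    c * (q / p) - eta <= (c - t) * (q / p) * expR (- (q * t)) - t].
  suff H : \forall t \near 0^'+, [/\ 0 < t < c,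
    (c + t) * (q / p) * expR (q * t) + t <= c * (q / p) + eta &
    c * (q / p) - eta <= (c - t) * (q / p) * expR (- (q * t)) - t].
    by have [t] := filter_ex H; exists t.
  near=> t; split.
  - by apply/andP; split; near: t; [exact: nbhs_right_gt|exact: nbhs_right_lt].
  - rewrite -{1 3}[t]mul1r; near: t; apply: cvgr_le (cvexp q 1) _ _.
    by rewrite ltrDl.
  - rewrite -{1 3}[t]mul1r -!mulNr; near: t; apply: cvgr_ge (cvexp (- q) (- 1)) _ _.
    by rewrite ltrBlDr ltrDl.
have H := bounds t t0c; near=> e.
have /andP[h1 h2] : (c - t) * (q / p) * expR (- (q * t)) - t <= E e / e ^+ m <=
    (c + t) * (q / p) * expR (q * t) + t by near: e; exact: H.
rewrite ler_distlC; apply/andP; split; first exact: le_trans h1.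
exact: le_trans h2 _.
Unshelve. all: by end_near. Qed.

End RecursiveAsymptotics.

(** * Measurability, and the functions F and E of the overview *)

Section Integrals.
Context {R : realType} {d : nat} (k : nat).
Hypothesis k_gt0 : (0 < k)%N.
Hypothesis k_le : (k <= d)%N.
Local Notation n := d.+1.
Local Notation V := 'rV[R]_n.
Local Notation mu := (@hausdorff_outer R n d).
Local Notation T := (caratheodory_type (hausdorff_outer_measure R n d)).
Local Notation H := (hausdorff_measure R n d).
Local Notation S := (unit_sphere R n : set T).

Lemma lipschitz_measurable (f : V -> R) :
  (forall x y, `|f x - f y| <= enorm (x - y)) ->
  measurable_fun setT (f : T -> R).
Proof.
move=> lip _; apply: (measurability _ (RGenOInfty.measurableE R)) => //.
move=> _ [_ [a ->] <-]; rewrite setTI.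
rewrite (_ : _ @^-1` _ = ~` ([set x | f x <= a] : set T)); last first.
  apply/seteqP; split=> x; rewrite /= in_itv /= andbT => ax; last by move/negP : ax; rewrite -ltNge.
  by apply/negP; rewrite -ltNge.
apply: measurableC; exact: lipschitz_sublevel_caratheodory.
Qed.

Lemma measurable_enorm : measurable_fun setT (@enorm R n : T -> R).
Proof. apply: lipschitz_measurable; exact: ler_dist_enorm. Qed.

Lemma measurable_head : measurable_fun setT ((fun x => enorm (headp k x)) : T -> R).
Proof. apply: lipschitz_measurable; exact: enorm_head_lipschitz. Qed.

Lemma measurable_tail_norm : measurable_fun setT (tail_norm k : T -> R).
Proof. apply: lipschitz_measurable; exact: tail_norm_lipschitz. Qed.

Lemma measurable_sublevel (f g : T -> R) : measurable_fun setT f -> measurable_fun setT g ->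
  measurable [set x | f x <= g x].
Proof.
move=> mf mg; rewrite -[X in measurable X]setTI.
rewrite (_ : [set x | _] = (fun x => f x <= g x) @^-1` [set true]) //.
exact: measurable_fun_ler.
Qed.

Lemma measurable_sphere : measurable S.
Proof.
have c1 : measurable_fun setT (cst 1 : T -> R) by exact: measurable_cst.
rewrite (_ : S = [set x | enorm x <= 1] `&` [set x | 1 <= enorm x]); last first.
  apply/seteqP; split=> x /=; first by rewrite /unit_sphere /= => ->.
  by move=> [x1 x2]; apply/eqP; rewrite eq_le x1.
apply: measurableI; first exact: (measurable_sublevel _ _ measurable_enorm c1).
exact: (measurable_sublevel _ _ c1 measurable_enorm).
Qed.

Lemma measurable_sphere_band s : measurable (sphere_band k s : set T).
Proof.
have cs : measurable_fun setT (cst s : T -> R) by exact: measurable_cst.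
apply: measurableI; first exact: measurable_sphere.
exact: (measurable_sublevel _ _ measurable_tail_norm cs).
Qed.

Definition bandF s : R := fine (mu (sphere_band k s)).

Lemma bandFE s : H (sphere_band k s) = (bandF s)%:E.
Proof. by rewrite fineK // ge0_fin_numE ?sphere_band_lty // hausdorff_outer_ge0. Qed.

(** The constant c of the overview: [-s, s]^m has side 2s, and [boxG] is the measure for side 1. *)
Definition band_const : R := 2 ^+ (n - k) * boxG (R := R) (d := d) k.

Lemma band_const_gt0 : 0 < band_const.
Proof. by rewrite mulr_gt0 ?exprn_gt0 ?boxG_gt0. Qed.

Lemma cvg_one_plus (a : R) : 1 + a * s @[s --> 0^'+] --> (1 : R).
Proof.
rewrite -[X in _ --> X]addr0 -[X in _ --> _ + X](mulr0 a).
by apply: cvg_at_right_filter; apply: cvgD; [exact: cvg_cst|apply: cvgM; [exact: cvg_cst|exact: cvg_id]].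
Qed.

Lemma cvg_exprn_one (f : R -> R) p : f s @[s --> 0^'+] --> (1 : R) -> f s ^+ p @[s --> 0^'+] --> (1 : R).
Proof.
move=> cvf; rewrite -[X in _ --> X](expr1n R p).
exact: (cvg_comp _ _ cvf (@exprn_continuous R p 1)).
Qed.

Lemma cvg_bandF : bandF s / s ^+ (n - k) @[s --> 0^'+] --> band_const.
Proof.
have c3 := cvg_exprn_one _ d (cvg_one_plus (3 * n%:R : R)).
have cl : band_const / (1 + 3 * n%:R * s) ^+ d @[s --> 0^'+] --> band_const.
  rewrite -[X in _ --> X]divr1; apply: cvgM; first exact: cvg_cst.
  by apply: cvgV => //; exact: oner_neq0.
have cu : (1 + 3 * n%:R * s) ^+ d * ((1 + 1 * s) ^+ (n - k) * band_const) @[s --> 0^'+] --> band_const.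
  rewrite -[X in _ --> X]mul1r; apply: cvgM => //.
  rewrite -[X in _ --> X]mul1r; apply: cvgM; last exact: cvg_cst.
  exact/cvg_exprn_one/cvg_one_plus.
apply: squeeze_cvgr cl cu; near=> s.
have s0 : 0 < s by near: s; exact: nbhs_right_gt.
have ns : n%:R * s <= 2^-1.
  rewrite -ler_pdivlMl //; apply: ltW; near: s; apply: nbhs_right_lt.
  by rewrite mulr_gt0.
have /andP[l u] := sphere_band_bounds k k_le s s0 ns.
have sp : 0 < s ^+ (n - k) by rewrite exprn_gt0.
rewrite ler_pdivlMr // ler_pdivrMr // /bandF; apply/andP; split.
  apply: le_trans l; rewrite /band_const exprMn le_eqVlt; apply/orP; left; apply/eqP; ring.
apply: le_trans u _; rewrite /band_const !exprMn mul1r le_eqVlt; apply/orP; left; apply/eqP; ring.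
Unshelve. all: by end_near. Qed.

Lemma powR_ge1 (x q : R) : 0 <= q -> 1 <= x -> 1 <= x `^ q.
Proof. by move=> q0 x1; rewrite -(powRr0 x) ler_powR. Qed.

Definition plateau (q t : R) := Num.max 1 t `^ (- q).

Lemma plateau_ge0 q t : 0 <= plateau q t.
Proof. exact: powR_ge0. Qed.

Lemma plateau_le1 q t : 0 <= q -> plateau q t <= 1.
Proof.
move=> q0; rewrite /plateau powRN invf_le1 ?powR_gt0 ?lt_max ?ltr01 //.
by rewrite powR_ge1 // le_max lexx.
Qed.

(** The rescaled plateau is max(lam, t)^(-q). It agrees with the original for t >= lam and is
    constant lam^(-q) below, where the original lies between lam^(-q) and 1 and equals 1 for t <=
    1. *)
Lemma plateau_rec q lam t : 0 <= q -> 1 < lam -> 0 <= t ->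
  (lam `^ q)^-1 * plateau q (t / lam) + (1 - (lam `^ q)^-1) * (t <= 1)%R%:R <= plateau q t <=
  (lam `^ q)^-1 * plateau q (t / lam) + (1 - (lam `^ q)^-1) * (t <= lam)%R%:R.
Proof.
move=> q0 lam1 t0; have lam0 : 0 < lam by apply: lt_trans lam1.
have L1 : 1 <= lam `^ q by rewrite powR_ge1 // ltW.
have Linv : (lam `^ q)^-1 <= 1 by rewrite invf_le1 // (lt_le_trans ltr01).
have P x : 0 <= x -> (lam `^ q)^-1 * plateau q (x / lam) = Num.max lam x `^ (- q).
  move=> x0; rewrite /plateau -powRN -powRM ?(ltW lam0) ?le_max ?ler01 //.
  by rewrite maxr_pMr ?ltW // mulr1 mulrC divfK // gt_eqF.
rewrite P // /plateau; have [tl|lt] := leP t lam.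
  rewrite (_ : true%:R = 1 :> R) // mulr1 (powRN lam) [X in _ && (_ <= X)]addrC subrK.
  have := plateau_le1 q t q0; rewrite /plateau => ->; rewrite andbT.
  have [t1|t1] := leP t 1; first by rewrite powRN powR1 invr1 mulr1 addrC subrK.
  rewrite mulr0 addr0 powRN lef_pV2 ?posrE ?powR_gt0 ?(lt_trans ltr01 t1) //.
  by apply: ge0_ler_powR; rewrite ?nnegrE // ltW.
have t1 := lt_trans lam1 lt; rewrite [t <= 1]leNgt t1 /= !mulr0 !addr0.
by rewrite (max_idPr (ltW t1)) lexx.
Qed.

Lemma measurable_plateau q e : measurable_fun setT ((fun u => plateau q (tail_norm k u / e)) : T -> R).
Proof.
apply: (measurableT_comp (measurable_powR (- q))).
apply: measurable_maxr; first exact: measurable_cst.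
by apply: measurable_funM; [exact: measurable_tail_norm|exact: measurable_cst].
Qed.

Definition plateauE q e : R :=
  fine (\int[H]_(u in S) (plateau q (tail_norm k u / e))%:E)%E.

Lemma plateauEE q e : 0 <= q ->
  (\int[H]_(u in S) (plateau q (tail_norm k u / e))%:E)%E = (plateauE q e)%:E /\
  0 <= plateauE q e <= fine (mu S).
Proof.
move=> q0; set I := (\int[H]_(u in S) _)%E.
have I0 : (0 <= I)%E by apply: integral_ge0 => u _; rewrite lee_fin plateau_ge0.
have Sfin : mu S \is a fin_num.
  by rewrite ge0_fin_numE ?hausdorff_outer_ge0 // hausdorff_outer_sphere_lty.
have IS : (I <= mu S)%E.
  rewrite -[leRHS]mul1e -(integral_cst H measurable_sphere 1%:E).
  apply: (ge0_le_integral H measurable_sphere).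
  - by move=> u _; rewrite lee_fin plateau_ge0.
  - by apply/measurable_EFinP/measurable_funTS; exact: measurable_plateau.
  - exact: measurable_cst.
  - by move=> u _; rewrite lee_fin plateau_le1.
have Ifin : I \is a fin_num by rewrite ge0_fin_numE // (le_lt_trans IS) // ltey_eq Sfin.
by rewrite fineK // fine_ge0 // fine_le.
Qed.

(** The pointwise inequality at t = h/e, integrated over the sphere; the indicators become the bands
    of width e and lam e. *)
Lemma plateauE_rec q lam e : 0 <= q -> 1 < lam -> 0 < e ->
  (lam `^ q)^-1 * plateauE q (lam * e) + (1 - (lam `^ q)^-1) * bandF e <= plateauE q e <=
  (lam `^ q)^-1 * plateauE q (lam * e) + (1 - (lam `^ q)^-1) * bandF (lam * e).
Proof.
move=> q0 lam1 e0; have lam0 : 0 < lam by apply: lt_trans lam1.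
have mS := measurable_sphere.
have L1 : 1 <= lam `^ q by rewrite powR_ge1 // ltW.
set L := (lam `^ q)^-1; have Linv : 0 <= 1 - L by rewrite subr_ge0 invf_le1 // (lt_le_trans ltr01).
have L0 : 0 <= L by rewrite invr_ge0 powR_ge0.
have mP c : measurable_fun S (fun u : T => (plateau q (tail_norm k u / c))%:E).
  by apply/measurable_EFinP/measurable_funTS; exact: measurable_plateau.
have mI s : measurable_fun S (fun u : T => (\1_(sphere_band k s : set T) u : R)%:E).
  by apply/measurable_EFinP/measurable_indic; exact: measurable_sphere_band.
pose f1 (u : T) := (L%:E * (plateau q (tail_norm k u / (lam * e)))%:E)%E.
pose f2 s (u : T) := ((1 - L)%:E * (\1_(sphere_band k s : set T) u : R)%:E)%E.
have mf1 : measurable_fun S f1 by apply: emeasurable_funM; [exact: measurable_cst|exact: mP].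
have mf2 s : measurable_fun S (f2 s) by apply: emeasurable_funM; [exact: measurable_cst|exact: mI].
have f10 u : S u -> (0 <= f1 u)%E by move=> _; rewrite mule_ge0 // lee_fin plateau_ge0.
have f20 s u : S u -> (0 <= f2 s u)%E by move=> _; rewrite mule_ge0 // lee_fin.
have mC s : measurable_fun S (fun u => (f1 u + f2 s u)%E) by exact: emeasurable_funD.
have comb s : (\int[H]_(u in S) (f1 u + f2 s u) =
    (L * plateauE q (lam * e) + (1 - L) * bandF s)%:E)%E.
  rewrite (ge0_integralD H mS f10 mf1 (f20 s) (mf2 s)).
  rewrite (ge0_integralZl H mS (mP (lam * e))); first last.
  - by rewrite lee_fin.
  - by move=> u _; rewrite lee_fin plateau_ge0.
  rewrite (ge0_integralZl H mS (mI s)); first last.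
  - by rewrite lee_fin.
  - by move=> u _; rewrite lee_fin.
  rewrite (integral_indic H mS (measurable_sphere_band s)).
  rewrite (_ : _ `&` S = sphere_band k s); last by apply: setIidl => u [].
  by rewrite (plateauEE _ _ q0).1 bandFE -!EFinM -EFinD.
have ptE u : tail_norm k u / (lam * e) = tail_norm k u / e / lam by rewrite invfM mulrA mulrAC.
have indE s (u : T) : S u -> 0 < s -> \1_(sphere_band k (s * e) : set T) u = (tail_norm k u / e <= s)%R%:R :> R.
  move=> Su s0; rewrite indicE ler_pdivrMr //; congr (_%:R); congr nat_of_bool.
  by apply/idP/idP => [|h]; rewrite inE; [case|split].
rewrite -!lee_fin -(plateauEE q e q0).1 -!comb; apply/andP; split.
  apply: (ge0_le_integral H mS _ (mC e) (mP e)) => u Su; first by rewrite adde_ge0 ?f10 ?f20.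
  rewrite /f1 /f2 -!EFinM -EFinD lee_fin ptE -{1}[e in sphere_band k e]mul1r indE ?ltr01 //.
  have te : 0 <= tail_norm k u / e by rewrite divr_ge0 ?tail_norm_ge0 // ltW.
  by have /andP[] := plateau_rec q lam (tail_norm k u / e) q0 lam1 te.
apply: (ge0_le_integral H mS _ (mP e) (mC (lam * e))) => u Su; first by rewrite lee_fin plateau_ge0.
rewrite /f1 /f2 -!EFinM -EFinD lee_fin ptE indE //.
have te : 0 <= tail_norm k u / e by rewrite divr_ge0 ?tail_norm_ge0 // ltW.
by have /andP[] := plateau_rec q lam (tail_norm k u / e) q0 lam1 te.
Qed.

Lemma cvg_plateauE q : (n - k)%:R < q ->
  plateauE q e / e ^+ (n - k) @[e --> 0^'+] --> band_const * (q / (q - (n - k)%:R)).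
Proof.
move=> mq; have q0 : 0 <= q by apply: le_trans (ltW mq).
apply: (recursive_asymptotic bandF (plateauE q) q band_const (fine (mu S))) => //.
- exact: band_const_gt0.
- exact: cvg_bandF.
- by move=> e e0; exact: (plateauEE q e q0).2.
- by move=> lam e lam1 e0; exact: plateauE_rec.
Qed.

End Integrals.

(** * Cylinders and their dual curvature *)

Section Bodies.
Context {R : realType} {n : nat} (k : nat).
Local Notation V := 'rV[R]_n.

Definition cylinder (e : R) : set V :=
  [set x | enorm (headp k x) <= 1 /\ tail_norm k x <= e].

(** For e > 0, the Minkowski functional of [cylinder e]. *)
Definition gauge (e : R) (x : V) : R := Num.max (enorm (headp k x)) (tail_norm k x / e).

Lemma enorm_lipschitz_continuous (f : V -> R) :
  (forall x y, `|f x - f y| <= enorm (x - y)) -> continuous f.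
Proof.
move=> lip x A /nbhs_ballP[eps /= eps0 epsA].
have n0 : 0 < n.+1%:R :> R by rewrite ltr0n.
(* Neighbourhoods are sup-norm balls and the Euclidean norm is at most n times the sup norm; n + 1
   is positive even for n = 0. *)
apply/nbhs_ballP; exists (eps / n.+1%:R) => [|y]; first by rewrite /= divr_gt0.
rewrite -ball_normE /ball_ /= ltr_pdivlMr // => h; apply: epsA.
rewrite -ball_normE /ball_ /=; apply: le_lt_trans (lip _ _) _.
apply: le_lt_trans (enorm_le_coord _ `|x - y| (normr_ge0 _) (coord_le_mx_norm _)) _.
by apply: le_lt_trans h; rewrite mulrC ler_wpM2l // ler_nat.
Qed.

Lemma closed_sublevel (f : V -> R) c :
  (forall x y, `|f x - f y| <= enorm (x - y)) -> closed [set x | f x <= c].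
Proof.
move=> lip; apply: (@preimage_closed _ _ f [set y | y <= c]); last exact: closed_le.
by move=> x _; exact: enorm_lipschitz_continuous.
Qed.

Lemma compact_cylinder e : compact (cylinder e).
Proof.
apply: bounded_closed_compact; last first.
  by apply: closedI; apply: closed_sublevel;
    [exact: enorm_head_lipschitz|exact: tail_norm_lipschitz].
exists (Num.max 1 e); split; first exact: num_real.
move=> M /ltW eM x [x1 xe]; apply: le_trans eM; rewrite [leLHS]/Num.norm /= mx_normrE.
apply/bigmax_leP; split=> [|[r i] _ /=]; first by rewrite le_max ler01.
rewrite ord1 le_max; have [ik|ki] := ltnP i k; apply/orP.
  left; apply: le_trans x1; apply: le_trans (coord_le_enorm _ i).
  by rewrite mxE ik.
by right; apply: le_trans xe; exact: coord_le_tail_norm.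
Qed.

Lemma tail_normD (x y : V) : tail_norm k (x + y) <= tail_norm k x + tail_norm k y.
Proof.
apply/tail_norm_leP; first by rewrite addr_ge0 ?tail_norm_ge0.
move=> i ki; rewrite mxE (le_trans (ler_normD _ _)) // lerD //; exact: coord_le_tail_norm.
Qed.

Lemma tail_normN (x : V) : tail_norm k (- x) = tail_norm k x.
Proof. by apply: eq_bigr => i _; rewrite mxE normrN. Qed.

Lemma convex_cylinder e : convex_set (cylinder e).
Proof.
move=> x y lam; rewrite !inE => -[x1 xe] [y1 ye].
have a0 : 0 <= lam%:num by [].
have a1 : 0 <= 1 - lam%:num by rewrite subr_ge0.
move: a0 a1; set a := lam%:num => a0 a1.
change (cylinder e (a *: (x : V) + (1 - a) *: (y : V))); split.
  rewrite headpD !headpZ (le_trans (ler_enormD _ _)) // !enormZ !ger0_norm //.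
  have := ler_wpM2l a0 x1; have := ler_wpM2l a1 y1; lra.
rewrite (le_trans (tail_normD _ _)) // !tail_normZ //.
have := ler_wpM2l a0 xe; have := ler_wpM2l a1 ye; lra.
Qed.

Lemma cylinder_convex_body_e e : 0 < e -> convex_body_e (cylinder e).
Proof.
move=> e0; have K0 : cylinder e 0.
  split; first by rewrite (_ : headp k 0 = 0) ?enorm0 ?ler01 //; apply/rowP => i; rewrite !mxE if_same.
  by apply/tail_norm_leP => [|i _]; rewrite ?(mxE, normr0) ltW.
split; first split; first split.
- by exists 0.
- exact: compact_cylinder.
- exact: convex_cylinder.
- have n0 : 0 < n.+1%:R :> R by rewrite ltr0n.
  apply/nbhs_ballP; exists (Num.min e n.+1%:R^-1) => /=; first by rewrite lt_min e0 invr_gt0.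
  move=> y; rewrite -ball_normE /ball_ /= sub0r normrN lt_min => /andP[/ltW ye /ltW y1].
  split; last first.
    by apply/tail_norm_leP => [|i _]; [exact: ltW|apply: le_trans ye; exact: coord_le_mx_norm].
  apply: le_trans (enorm_head_le k y) _.
  apply: le_trans (enorm_le_coord _ `|y| (normr_ge0 _) (coord_le_mx_norm _)) _.
  rewrite -[leRHS](mulfV (lt0r_neq0 n0)); apply: ler_pM => //.
  by rewrite ler_nat.
- have KN x : cylinder e x -> cylinder e (- x).
    move=> [x1 xe]; split; last by rewrite tail_normN.
    by rewrite -scaleN1r headpZ scaleN1r enormN.
  apply/seteqP; split=> [x xK|_ [x xK <-]]; last exact: KN.
  by exists (- x); [exact: KN|rewrite opprK].
Qed.

Section Radial.
Variable e : R.
Hypothesis e0 : 0 < e.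

Lemma gauge_gt0 u : unit_sphere R n u -> 0 < gauge e u.
Proof.
move=> u1; rewrite /gauge lt_max; have [//|h0] := ltP 0 (enorm (headp k u)).
rewrite /= divr_gt0 // ltNge; apply/negP => t0.
have : enorm u <= 0.
  rewrite -(headDtail k u) (le_trans (ler_enormD _ _)) // -[leRHS]addr0 lerD //.
  apply: le_trans (enorm_tail_le_tail_norm k u) _.
  by rewrite (le_anti (introT andP (conj t0 (tail_norm_ge0 k u)))) mulr0.
by rewrite u1 leNgt ltr01.
Qed.

Lemma radial_cylinder u : unit_sphere R n u -> radial_fun (cylinder e) u = (gauge e u)^-1.
Proof.
move=> u1; have g0 := gauge_gt0 u u1.
have KP r : 0 < r -> cylinder e (r *: u) <-> r * gauge e u <= 1.
  move=> r0; rewrite /cylinder /= headpZ enormZ gtr0_norm // tail_normZ ?(ltW r0) //.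
  rewrite /gauge maxr_pMr ?(ltW r0) // ge_max mulrA ler_pdivrMr // mul1r.
  by split=> [[-> ->]|/andP[]].
have ub : ubound [set r : R | 0 < r /\ cylinder e (r *: u)] (gauge e u)^-1.
  by move=> r [r0 /(KP r r0)]; rewrite -ler_pdivlMr // div1r.
have mem : [set r : R | 0 < r /\ cylinder e (r *: u)] (gauge e u)^-1.
  have i0 : 0 < (gauge e u)^-1 by rewrite invr_gt0.
  by split=> //; apply/(KP _ i0); rewrite mulVf // gt_eqF.
apply/eqP; rewrite eq_le; apply/andP; split; first by apply: ge_sup ub; exists (gauge e u)^-1.
by apply: ub_le_sup mem; exists (gauge e u)^-1.
Qed.

Lemma support_fun_eq (K : set V) v y : K y -> (forall z, K z -> dotp v z <= dotp v y) ->
  support_fun K v = dotp v y.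
Proof.
move=> Ky maxy.
have ub : ubound [set dotp v z | z in K] (dotp v y) by move=> _ [z Kz <-]; exact: maxy.
have mem : [set dotp v z | z in K] (dotp v y) by exists y.
apply/eqP; rewrite eq_le; apply/andP; split; first by apply: ge_sup ub; exists (dotp v y).
by apply: ub_le_sup mem; exists (dotp v y).
Qed.

Lemma dotp_head (v x : V) : tailp k v = 0 -> dotp v x = dotp v (headp k x).
Proof.
move=> v0; apply: eq_bigr => i _; rewrite mxE; case: ltnP => // ki.
by have /rowP/(_ i) := v0; rewrite !mxE ltnNge ki /= => ->; rewrite !mul0r.
Qed.

Lemma tailp0_head (v : V) : tailp k v = 0 -> headp k v = v.
Proof. by move=> v0; rewrite -[RHS](headDtail k) v0 addr0. Qed.

Lemma support_cylinder_head v : unit_sphere R n v -> tailp k v = 0 ->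
  support_fun (cylinder e) v = 1.
Proof.
move=> v1 v0; have vv : dotp v v = 1 by rewrite -enorm_sqr v1 expr1n.
rewrite (support_fun_eq _ _ v) ?vv //.
  split; first by rewrite tailp0_head // v1.
  apply/tail_norm_leP => [|i ki]; first exact: ltW.
  by have /rowP/(_ i) := v0; rewrite !mxE ltnNge ki /= => ->; rewrite normr0 ltW.
move=> z [z1 _]; rewrite dotp_head // (le_trans (cauchy_schwarz _ _)) //.
by rewrite v1 mul1r.
Qed.

(** For a unit vector v in L one has <u, v> <= |head u| <= gauge u, and v supports at the boundary
    point over u only if the ends agree. Conversely the normalized head of u is then a normal. *)
Lemma reverse_radial_gauss_head :
  reverse_radial_gauss (cylinder e) (unit_sphere R n `&` [set v | tailp k v = 0]) =
  [set u | unit_sphere R n u /\ tail_norm k u / e <= enorm (headp k u)].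
Proof.
apply/seteqP; split=> u [u1].
  move=> [v [v1 v0]]; rewrite /supporting_hyperplane /= support_cylinder_head //.
  rewrite dotpZl radial_cylinder // => h; split=> //.
  have g0 := gauge_gt0 u u1.
  have : gauge e u <= enorm (headp k u).
    rewrite -[leLHS]mulr1 -h mulrA divff ?gt_eqF // mul1r dotpC dotp_head //.
    by rewrite (le_trans (cauchy_schwarz _ _)) // v1 mul1r.
  by apply: le_trans; rewrite /gauge le_max lexx orbT.
move=> hu; split=> //; have g0 := gauge_gt0 u u1.
have gE : gauge e u = enorm (headp k u) by exact/max_idPl.
have v0 : tailp k ((enorm (headp k u))^-1 *: headp k u) = 0.
  by rewrite tailpZ tailp_headp scaler0.
have v1 : unit_sphere R n ((enorm (headp k u))^-1 *: headp k u).
  by rewrite /unit_sphere /= -gE enormZ -gE ger0_norm ?invr_ge0 ?(ltW g0) // mulVf // gt_eqF.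
exists ((enorm (headp k u))^-1 *: headp k u) => //.
rewrite /supporting_hyperplane /= support_cylinder_head // dotpZl radial_cylinder //.
rewrite dotpC dotp_head // dotpZl -enorm_sqr gE expr2 mulKf ?mulVf // -gE gt_eqF //.
Qed.

(** Every boundary point has a normal: in L if the head dominates the gauge, otherwise a signed
    basis vector along the largest tail coordinate. *)
Lemma reverse_radial_gauss_sphere :
  reverse_radial_gauss (cylinder e) (unit_sphere R n) = unit_sphere R n.
Proof.
apply/seteqP; split=> u; first by case.
move=> u1; have [hu|uh] := leP (tail_norm k u / e) (enorm (headp k u)).
  have : reverse_radial_gauss (cylinder e) (unit_sphere R n `&` [set v | tailp k v = 0]) u.
    by rewrite reverse_radial_gauss_head.
  by move=> [_ [v [v1 _] uv]]; split=> //; exists v.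
have t0 : 0 < tail_norm k u.
  by have := le_lt_trans (enorm_ge0 _) uh; rewrite pmulr_lgt0 // invr_gt0.
have gE : gauge e u = tail_norm k u / e by apply/max_idPr/ltW.
have [i ki ui] : exists2 i : 'I_n, (k <= i)%N & tail_norm k u <= `|u ord0 i|.
  have /bigmax_geP[|//] := lexx (tail_norm k u).
  by rewrite leNgt t0.
have {}ui : `|u ord0 i| = tail_norm k u by apply/eqP; rewrite eq_le ui coord_le_tail_norm.
have u0 : u ord0 i != 0 by rewrite -normr_gt0 ui.
have dn : enorm (delta_mx 0 i : V) = 1 by rewrite /enorm dotp_delta mxE !eqxx sqrtr1.
(* The outer normal of the facet |x_i| = e on the side of u; the support function is attained at e
   v. *)
pose v : V := Num.sg (u ord0 i) *: delta_mx 0 i.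
split=> //; exists v.
  by rewrite /unit_sphere /= enormZ dn mulr1 normr_sg u0.
have ve : dotp v (e *: v) = e.
  rewrite dotpZr dotpZl dotpZr dotp_delta mxE !eqxx mulr1 -expr2 sqr_sg u0 mulr1 //.
rewrite /supporting_hyperplane /= (support_fun_eq _ _ (e *: v)).
- rewrite ve dotpZl dotpC dotpZl dotpC dotp_delta -normrEsg ui radial_cylinder // gE invfM invrK.
  by rewrite mulrAC mulVf ?mul1r // gt_eqF.
- split.
    rewrite headpZ (_ : headp k v = 0) ?scaler0 ?enorm0 ?ler01 //.
    apply/rowP => j; rewrite !mxE eqxx /=; case: ltnP => // jk.
    by case: eqP => [ji|]; rewrite ?mulr0 //; move: jk; rewrite ji ltnNge ki.
  rewrite tail_normZ ?(ltW e0) // ler_piMr ?(ltW e0) //.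
  by apply: le_trans (tail_norm_le_enorm k v) _; rewrite enormZ dn mulr1 normr_sg u0.
- move=> z [_ ze]; rewrite ve dotpZl dotpC dotp_delta (le_trans (ler_norm _)) // normrM normr_sg u0 mul1r.
  by apply: le_trans ze; exact: coord_le_tail_norm.
Qed.

End Radial.

End Bodies.

(** The subspace is the image of the embedding of R^k by zero padding; its right inverse Q gives
    injectivity, hence the dimension, and the preimages. *)
Lemma coordinate_subspace {R : fieldType} (n k : nat) : (k <= n)%N ->
  exists L : {vspace 'rV[R]_n}, \dim L = k /\
    forall u : 'rV[R]_n, (u \in L) = [forall i : 'I_n, (k <= i)%N ==> (u ord0 i == 0)].
Proof.
move=> kn; pose P : 'M[R]_(k, n) := pid_mx k; pose Q : 'M[R]_(n, k) := pid_mx k.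
have PQ : P *m Q = 1%:M by rewrite mul_pid_mx !minnn (minn_idPr kn) pid_mx_1.
exists (limg (linfun (mulmxr P))); split.
  rewrite limg_dim_eq ?dimvf /dim /= ?mul1n //.
  apply/eqP; rewrite -subv0; apply/subvP => y; rewrite memv_cap memvf /= memv_ker lfunE /= => /eqP y0.
  by rewrite memv0 -[y]mulmx1 -PQ mulmxA y0 mul0mx.
move=> u; apply/memv_imgP/forallP => [[y _ ->] i|u0].
  apply/implyP => ki; rewrite lfunE /= mxE big1 // => j _.
  by rewrite mxE (ltn_eqF (leq_trans (ltn_ord j) ki)) mulr0.
exists (u *m Q); first exact: memvf.
rewrite lfunE /= -mulmxA mul_pid_mx minnn (minn_idPr (leqnn k)).
apply/rowP => i; rewrite mxE (bigD1 i) //= mxE eqxx /= big1 ?addr0 => [|j ji].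
  case: ltnP => ik; first by rewrite mulr1.
  by rewrite mulr0; apply/eqP; have /implyP := u0 i; apply.
by rewrite mxE (_ : (j == i :> nat) = false) ?mulr0 //; exact/negbTE.
Qed.

Lemma fine_bounds {R : realType} (x : \bar R) (a b : R) : x \is a fin_num ->
  (a%:E <= x)%E -> (x <= b%:E)%E -> a <= fine x <= b.
Proof. by move=> xfin ax xb; rewrite -!lee_fin fineK // ax. Qed.

(** * Comparison of the dual curvatures with E and F, and the limit *)

Section Ratio.
Context {R : realType} {d : nat} (k : nat) (q : R).
Hypothesis k_gt0 : (0 < k)%N.
Hypothesis k_le : (k <= d)%N.
Local Notation n := d.+1.
Hypothesis q_gt : n%:R < q.
Local Notation V := 'rV[R]_n.
Local Notation mu := (@hausdorff_outer R n d).
Local Notation T := (caratheodory_type (hausdorff_outer_measure R n d)).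
Local Notation H := (hausdorff_measure R n d).
Local Notation S := (unit_sphere R n : set T).

Let q_ge0 : 0 <= q. Proof. by apply: le_trans (ltW q_gt). Qed.

Definition head_part (e : R) : set T :=
  [set u | unit_sphere R n u /\ tail_norm k u / e <= enorm (headp k u)].

Definition gauge_integral (e : R) (A : set T) : \bar R :=
  (\int[H]_(u in A) (gauge k e u `^ (- q))%:E)%E.

Lemma measurable_head_part e : measurable (head_part e).
Proof.
apply: measurableI; first exact: measurable_sphere.
apply: measurable_sublevel; last exact: measurable_head.
by apply: measurable_funM; [exact: measurable_tail_norm|exact: measurable_cst].
Qed.

Lemma measurable_gauge e (A : set T) :
  measurable_fun A (fun u : T => (gauge k e u `^ (- q))%:E).
Proof.
apply/measurable_EFinP/measurable_funTS; apply: (measurableT_comp (measurable_powR (- q))).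
apply: measurable_maxr; first exact: measurable_head.
by apply: measurable_funM; [exact: measurable_tail_norm|exact: measurable_cst].
Qed.

Lemma dual_curvature_sphere e : 0 < e ->
  dual_curvature q (cylinder k e) (unit_sphere R n) = ((n%:R^-1)%:E * gauge_integral e S)%E.
Proof.
move=> e0; rewrite /dual_curvature (reverse_radial_gauss_sphere k e e0).
apply: (congr1 (fun z => ((n%:R^-1)%:E * z)%E)); apply: eq_integral => u; rewrite inE => u1; rewrite radial_cylinder //.
by rewrite -powR_inv1 ?(ltW (gauge_gt0 k e e0 u u1)) // -powRrM mulN1r.
Qed.

Lemma dual_curvature_head e : 0 < e ->
  dual_curvature q (cylinder k e) (unit_sphere R n `&` [set u | tailp k u = 0]) =
  ((n%:R^-1)%:E * gauge_integral e (head_part e))%E.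
Proof.
move=> e0; rewrite /dual_curvature (reverse_radial_gauss_head k e e0).
apply: (congr1 (fun z => ((n%:R^-1)%:E * z)%E)); apply: eq_integral => u; rewrite inE => -[u1 _]; rewrite radial_cylinder //.
by rewrite -powR_inv1 ?(ltW (gauge_gt0 k e e0 u u1)) // -powRrM mulN1r.
Qed.

Lemma ler_powRN (x y : R) : 0 < x -> x <= y -> y `^ (- q) <= x `^ (- q).
Proof.
move=> x0 xy; have y0 := lt_le_trans x0 xy.
rewrite !powRN lef_pV2 ?posrE ?powR_gt0 //.
by apply: ge0_ler_powR; rewrite ?nnegrE // ltW.
Qed.

Section small.
Variable e : R.
Hypothesis e0 : 0 < e.
Hypothesis ne : n%:R * e <= 2^-1.
Let r : R := 1 - n%:R * e.

Let ne1 : n%:R * e < 1. Proof. by apply: le_lt_trans ne _; rewrite invf_lt1 // ltr1n. Qed.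
Let r_gt0 : 0 < r. Proof. by rewrite subr_gt0. Qed.
Let r_le1 : r <= 1. Proof. by rewrite lerBlDr lerDl mulr_ge0 // ltW. Qed.

(** On the sphere r max(1, h/e) <= gauge <= max(1, h/e): where h <= e the head has length at least r
    = 1 - n e, and elsewhere h/e exceeds 1. *)
Lemma gauge_integral_sphere_bounds :
  (gauge_integral e S = (fine (gauge_integral e S))%:E)%E /\
  plateauE (R := R) (d := d) k q e <= fine (gauge_integral e S) <=
    r `^ (- q) * plateauE (R := R) (d := d) k q e.
Proof.
have [PE _] := plateauEE (d := d) k q e q_ge0.
have mS : measurable S by exact: measurable_sphere.
have mP : measurable_fun S (fun u : T => (plateau q (tail_norm k u / e))%:E).
  by apply/measurable_EFinP/measurable_funTS; exact: measurable_plateau.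
have lo : ((plateauE (R := R) (d := d) k q e)%:E <= gauge_integral e S)%E.
  rewrite -PE; apply: (ge0_le_integral H mS _ mP (measurable_gauge e S)) => u u1.
    by rewrite lee_fin plateau_ge0.
  rewrite lee_fin; apply: ler_powRN; first exact: gauge_gt0.
  rewrite /gauge ge_max !le_max lexx orbT andbT; apply/orP; left.
  by apply: le_trans (enorm_head_le k u) _; rewrite u1.
have up : (gauge_integral e S <= (r `^ (- q) * plateauE (R := R) (d := d) k q e)%:E)%E.
  rewrite EFinM -PE -(ge0_integralZl H mS mP); first last.
  - by rewrite lee_fin powR_ge0.
  - by move=> u _; rewrite lee_fin plateau_ge0.
  have mrP : measurable_fun S (fun u : T => ((r `^ (- q))%:E * (plateau q (tail_norm k u / e))%:E)%E).
    by apply: emeasurable_funM; [exact: measurable_cst|exact: mP].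
  apply: (ge0_le_integral H mS _ (measurable_gauge e S) mrP) => u u1; first by rewrite lee_fin powR_ge0.
  rewrite -EFinM lee_fin /plateau -powRM ?le_max ?ler01 ?(ltW r_gt0) //.
  have t0 : 0 <= tail_norm k u / e by rewrite divr_ge0 ?tail_norm_ge0 // ltW.
  apply: ler_powRN; first by rewrite mulr_gt0 // lt_max ltr01.
  rewrite maxr_pMr ?(ltW r_gt0) // mulr1 ge_max; apply/andP; split.
    rewrite /gauge le_max; have [te|et] := leP (tail_norm k u) e.
      by rewrite (enorm_head_ge k u e) // ltW.
    by apply/orP; right; apply: le_trans r_le1 _; rewrite ler_pdivlMr // mul1r ltW.
  by rewrite /gauge le_max ler_piMl ?orbT.
have fin : gauge_integral e S \is a fin_num.
  rewrite ge0_fin_numE ?(le_lt_trans up) ?ltry //.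
  by apply: integral_ge0 => u _; rewrite lee_fin powR_ge0.
split; first by rewrite (fineK fin).
exact: fine_bounds fin lo up.
Qed.

(** The head part lies between the bands of widths r e and e, and on it the gauge is the length of
    the head, which lies in [r, 1]. *)
Lemma gauge_integral_head_bounds :
  (gauge_integral e (head_part e) = (fine (gauge_integral e (head_part e)))%:E)%E /\
  bandF (R := R) (d := d) k (r * e) <= fine (gauge_integral e (head_part e)) <=
    r `^ (- q) * bandF (R := R) (d := d) k e.
Proof.
have mA := measurable_head_part e.
have headle u : unit_sphere R n u -> enorm (headp k u) <= 1.
  by move=> u1; apply: le_trans (enorm_head_le k u) _; rewrite u1.
have sub1 : (sphere_band k (r * e) : set T) `<=` head_part e.
  move=> u [u1 ut]; split=> //; rewrite ler_pdivrMr //; apply: (le_trans ut).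
  rewrite ler_wpM2r ?(ltW e0) // (enorm_head_ge k u e) //; last exact: ltW.
  by apply: le_trans ut _; rewrite ler_piMl // ltW.
have sub2 : head_part e `<=` (sphere_band k e : set T).
  move=> u [u1]; rewrite ler_pdivrMr // => ut; split=> //; apply: le_trans ut _.
  by rewrite ler_piMl ?(ltW e0) // headle.
have lo : ((bandF (R := R) (d := d) k (r * e))%:E <= gauge_integral e (head_part e))%E.
  rewrite -bandFE; apply: (@le_trans _ _ (H (head_part e))).
    exact: le_hausdorff_outer.
  rewrite -[leLHS]mul1e -(integral_cst H mA 1%:E).
  apply: (ge0_le_integral H mA _ (measurable_cst _) (measurable_gauge e _)) => u [u1 ut].
    by rewrite lee_fin.
  rewrite lee_fin -[leLHS](congr1 (@^~ (- q)) (powR1 R)).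
  apply: ler_powRN; first exact: gauge_gt0.
  rewrite /gauge ge_max headle //=; exact: le_trans ut (headle u u1).
have up : (gauge_integral e (head_part e) <= (r `^ (- q) * bandF (R := R) (d := d) k e)%:E)%E.
  rewrite EFinM -bandFE; apply: (@le_trans _ _ ((r `^ (- q))%:E * H (head_part e))%E).
    rewrite -(integral_cst H mA).
    apply: (ge0_le_integral H mA _ (measurable_gauge e _) (measurable_cst _)) => u uA.
      by rewrite lee_fin powR_ge0.
    have [u1 ue] := sub2 u uA; rewrite lee_fin; apply: ler_powRN => //.
    by rewrite /gauge le_max (enorm_head_ge k u e) // ltW.
  rewrite lee_wpmul2l ?lee_fin ?powR_ge0 //; exact: le_hausdorff_outer.
have fin : gauge_integral e (head_part e) \is a fin_num.
  rewrite ge0_fin_numE ?(le_lt_trans up) ?ltry //.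
  by apply: integral_ge0 => u _; rewrite lee_fin powR_ge0.
split; first by rewrite (fineK fin).
exact: fine_bounds fin lo up.
Qed.

End small.

Local Notation m := (n - k)%N.

Lemma near_small : \forall e \near (0 : R)^'+, 0 < e /\ n%:R * e <= 2^-1.
Proof.
near=> e; split; first by near: e; exact: nbhs_right_gt.
rewrite -ler_pdivlMl //; apply: ltW; near: e; apply: nbhs_right_lt.
by rewrite mulr_gt0.
Unshelve. all: by end_near. Qed.

Lemma cvg_one_minus (a : R) : 1 - a * s @[s --> 0^'+] --> (1 : R).
Proof. by have := cvg_one_plus (- a); under eq_fun do rewrite mulNr. Qed.

Lemma cvg_radius_powR : (1 - n%:R * s) `^ (- q) @[s --> 0^'+] --> (1 : R).
Proof.
rewrite -[X in _ --> X](_ : 1 `^ (- q) = 1); last by rewrite powR1.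
have cont : {for (1 : R), continuous (fun x : R => x `^ (- q))}.
  apply/differentiable_continuous/derivable1_diffP; apply: derivable_powR.
  by rewrite in_itv /= andbT ltr01.
exact: (cvg_comp _ _ (cvg_one_minus (n%:R : R)) cont).
Qed.

Lemma cvg_gauge_sphere :
  fine (gauge_integral e S) / e ^+ m @[e --> 0^'+] -->
  band_const (R := R) (d := d) k * (q / (q - m%:R)).
Proof.
have mq : m%:R < q by apply: le_lt_trans q_gt; rewrite ler_nat leq_subr.
have cl := cvg_plateauE k k_gt0 k_le q mq.
have cu : (1 - n%:R * e) `^ (- q) * (plateauE (R := R) (d := d) k q e / e ^+ m) @[e --> 0^'+] -->
    band_const (R := R) (d := d) k * (q / (q - m%:R)).
  by rewrite -[X in _ --> X]mul1r; apply: cvgM => //; exact: cvg_radius_powR.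
apply: squeeze_cvgr cl cu; near=> e.
have [e0 ne] : 0 < e /\ n%:R * e <= 2^-1 by near: e; exact: near_small.
have em0 : 0 <= (e ^+ m)^-1 by rewrite invr_ge0 exprn_ge0 // ltW.
have [_ /andP[l u]] := gauge_integral_sphere_bounds e e0 ne.
by rewrite mulrA; apply/andP; split; [exact: (ler_wpM2r em0 l)|exact: (ler_wpM2r em0 u)].
Unshelve. all: by end_near. Qed.

Lemma cvg_gauge_head :
  fine (gauge_integral e (head_part e)) / e ^+ m @[e --> 0^'+] -->
  band_const (R := R) (d := d) k.
Proof.
have cb := cvg_bandF (R := R) k k_le.
have c3 := cvg_exprn_one _ d (cvg_one_plus (3 * n%:R : R)).
have cl : (1 - n%:R * s) ^+ m * (band_const (R := R) (d := d) k / (1 + 3 * n%:R * s) ^+ d)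
    @[s --> 0^'+] --> band_const (R := R) (d := d) k.
  rewrite -[X in _ --> X]mul1r; apply: cvgM; first exact/cvg_exprn_one/cvg_one_minus.
  rewrite -[X in _ --> X]divr1; apply: cvgM; first exact: cvg_cst.
  by apply: (cvgV _ c3); exact: oner_neq0.
have cu : (1 - n%:R * e) `^ (- q) * (bandF (R := R) (d := d) k e / e ^+ m) @[e --> 0^'+] -->
    band_const (R := R) (d := d) k.
  by rewrite -[X in _ --> X]mul1r; apply: cvgM => //; exact: cvg_radius_powR.
apply: squeeze_cvgr cl cu; near=> e.
have [e0 ne] : 0 < e /\ n%:R * e <= 2^-1 by near: e; exact: near_small.
have em0 : 0 < (e ^+ m)^-1 by rewrite invr_gt0 exprn_gt0.
have [_ /andP[l u]] := gauge_integral_head_bounds e e0 ne.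
apply/andP; split; last by rewrite mulrA ler_pM2r.
apply: (@le_trans _ _ (bandF (R := R) (d := d) k ((1 - n%:R * e) * e) / e ^+ m)); last by rewrite ler_pM2r.
set r := 1 - n%:R * e; have r0 : 0 < r by rewrite subr_gt0 (le_lt_trans ne) // invf_lt1 // ltr1n.
have r1 : r <= 1 by rewrite lerBlDr lerDl mulr_ge0 // ltW.
have re0 : 0 < r * e by rewrite mulr_gt0.
have ree : n%:R * (r * e) <= n%:R * e by rewrite ler_wpM2l // ler_piMl // ltW.
(* The explicit bound at width r e avoids a limit of F along the moving argument (1 - n e) e. *)
have /andP[h _] := sphere_band_bounds k k_le (r * e) re0 (le_trans ree ne).
rewrite ler_pdivlMr ?exprn_gt0 //; apply: le_trans h.
rewrite [leLHS](_ : _ = (2 * (r * e)) ^+ m * boxG (R := R) (d := d) k / (1 + 3 * n%:R * e) ^+ d); last first.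
  by rewrite /band_const !exprMn; ring.
rewrite ler_wpM2l //; first by rewrite mulr_ge0 ?exprn_ge0 ?mulr_ge0 ?(ltW re0) // ltW // boxG_gt0.
have k0 : 0 < 1 + 3 * n%:R * (r * e) by rewrite ltr_pwDl // !mulr_ge0 // ltW.
have k1 : 1 + 3 * n%:R * (r * e) <= 1 + 3 * n%:R * e by rewrite lerD2l -!mulrA ler_wpM2l.
rewrite lef_pV2 ?posrE ?exprn_gt0 ?(lt_le_trans k0 k1) //.
by apply: lerXn2r; rewrite ?nnegrE ?(ltW k0) ?(ltW (lt_le_trans k0 k1)).
Unshelve. all: by end_near. Qed.

Lemma cvg_harmonic_right : (l.+1%:R^-1 : R) @[l --> \oo] --> (0 : R)^'+.
Proof.
move=> P P0.
have near_oo : \forall l \near \oo, 0 < l.+1%:R^-1 :> R -> P l.+1%:R^-1 := @cvg_harmonic R _ P0.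
by apply: filterS near_oo => l; apply; rewrite invr_gt0.
Qed.

Lemma cvg_dual_curvature_ratio :
  (dual_curvature q (cylinder k l.+1%:R^-1%R) (unit_sphere R n `&` [set u | tailp k u = 0%R])
    / dual_curvature q (cylinder k l.+1%:R^-1%R) (unit_sphere R n))%E @[l --> \oo]
  --> ((q - n%:R + k%:R) / q)%:E.
Proof.
have q0 : 0 < q by apply: le_lt_trans q_gt.
have mE : m%:R = n%:R - k%:R :> R by rewrite natrB // leqW.
have mq : m%:R < q by apply: le_lt_trans q_gt; rewrite ler_nat leq_subr.
pose A e := fine (gauge_integral e (head_part e)).
pose B e := fine (gauge_integral e S).
have bc0 := band_const_gt0 (R := R) k k_gt0 k_le.
have lim0 : band_const (R := R) (d := d) k * (q / (q - m%:R)) != 0.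
  by rewrite gt_eqF // mulr_gt0 // divr_gt0 // subr_gt0.
have cvR : A e / B e @[e --> 0^'+] --> (q - n%:R + k%:R) / q.
  have -> : (q - n%:R + k%:R) / q =
      band_const (R := R) (d := d) k / (band_const (R := R) (d := d) k * (q / (q - m%:R))).
    have qm : q - (n%:R - k%:R) != 0 by rewrite -mE subr_eq0 gt_eqF.
    rewrite mE; move: qm; set N : R := n%:R; move: N => N qm.
    by field; rewrite qm (gt_eqF q0) (gt_eqF bc0).
  (* Both integrals are of order e^m, so this normalization makes the two limits finite and the
     lower one nonzero; c then cancels. *)
  have cvM : (A e / e ^+ m) / (B e / e ^+ m) @[e --> 0^'+] -->
      band_const (R := R) (d := d) k / (band_const (R := R) (d := d) k * (q / (q - m%:R))).
    by apply: cvgM; [exact: cvg_gauge_head|apply: (cvgV lim0); exact: cvg_gauge_sphere].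
  apply: (cvg_trans _ cvM); apply: near_eq_cvg; near=> e.
  have e0 : 0 < e by near: e; exact: nbhs_right_gt.
  rewrite /=; move: (A e) (B e) => a b.
  by rewrite invfM invrK mulrACA mulVf ?mulr1 // expf_neq0 // gt_eqF.
have cvB : B e / e ^+ m @[e --> 0^'+] --> band_const (R := R) (d := d) k * (q / (q - m%:R)).
  exact: cvg_gauge_sphere.
have cvE : (A e / B e)%:E @[e --> 0^'+] --> ((q - n%:R + k%:R) / q)%:E.
  by apply: cvg_EFin => //; exact: nearW.
pose G e := (dual_curvature q (cylinder k e) (unit_sphere R n `&` [set u | tailp k u = 0%R])
  / dual_curvature q (cylinder k e) (unit_sphere R n))%E.
suff cvG : G e @[e --> 0^'+] --> ((q - n%:R + k%:R) / q)%:E.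
  exact: (cvg_comp _ _ cvg_harmonic_right cvG).
apply: (cvg_trans _ cvE); apply: near_eq_cvg; near=> e.
have [e0 ne] : 0 < e /\ n%:R * e <= 2^-1 by near: e; exact: near_small.
(* The extended-real quotient is the real one only for a nonzero denominator, which the positive
   limit guarantees for small e. *)
have : B e / e ^+ m != 0 by near: e; exact: cvgr_neq0 cvB lim0.
rewrite mulf_eq0 negb_or => /andP[Be0 _].
rewrite /G (dual_curvature_sphere e e0) (dual_curvature_head e e0).
have [-> _] := gauge_integral_sphere_bounds e e0 ne.
have [-> _] := gauge_integral_head_bounds e e0 ne.
move: Be0; rewrite -/(A e) -/(B e); move: (A e) (B e) => a b b0.
have n0 : n%:R != 0 :> R by rewrite pnatr_eq0.
rewrite -!EFinM inver mulf_eq0 invr_eq0 (negbTE n0) (negbTE b0) -EFinM; congr (_%:E).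
by rewrite invfM invrK mulrACA mulVf // mul1r.
Unshelve. all: by end_near. Qed.

End Ratio.

Theorem proposition1p8 (R : realType) (n k : nat) (q : R)
    (hk0 : (1 <= k)%N) (hkn : (k <= n - 1)%N) (hq : n%:R < q) :
  exists (K : nat -> set 'rV[R]_n) (L : {vspace 'rV[R]_n}),
    [/\ forall l : nat, convex_body_e (K l),
        \dim L = k &
        (dual_curvature q (K l) (unit_sphere R n `&` [set u | u \in L])
          / dual_curvature q (K l) (unit_sphere R n))%E @[l --> \oo]
          --> ((q - n%:R + k%:R) / q)%:E].
Proof.
(* For n = 0 the truncated difference n - 1 is 0, contradicting 1 <= k. *)
case: n hkn hq => [|d] hkn hq; first by move: hkn; rewrite leqn0 => /eqP k0; rewrite k0 in hk0.
have kd : (k <= d)%N by rewrite subn1 in hkn.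
have [L [dimL memL]] := @coordinate_subspace R d.+1 k (leqW kd).
exists (fun l => cylinder k l.+1%:R^-1), L; split=> // [l|].
  by apply: cylinder_convex_body_e; rewrite invr_gt0.
have -> : [set u | u \in L] = [set u | tailp k u = 0].
  apply/seteqP; split=> u /=; rewrite memL.
    move=> /forallP u0; apply/rowP => i; rewrite !mxE; case: ltnP => // ki.
    by apply/eqP; have /implyP := u0 i; apply.
  move=> /rowP u0; apply/forallP => i; apply/implyP => ki.
  by have := u0 i; rewrite !mxE ltnNge ki /= => ->.
exact: cvg_dual_curvature_ratio.
Qed.
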